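(* Let $X$ be a complex Banach space and let $E,F$ be bounded linear operators on $X$ that have g-Drazin inverses $E^d,F^d$. Put $E^{\pi}=I-EE^d$ and $F^{\pi}=I-FF^d$. If $EF^2=0$ and $EFE=0$, then the operator matrix $M=\begin{pmatrix}E&I\\ F&0\end{pmatrix}$ on $X\oplus X$ has a g-Drazin inverse, and $$M^d=\begin{pmatrix}\Gamma&\Delta\\ \Lambda&\Xi\end{pmatrix},$$ where $$\begin{aligned} \Gamma={}&E^d+(E^d)^3F-F^dE^dF-(F^d)^2E^2E^dF-FF^dE^d+F^dEE^{\pi}+(F^d)^2EF\\ &-FF^d(E^d)^3F+(F^d)^3E^3E^{\pi}F+\sum_{i=1}^{\infty}F^{i}F^{\pi}E^{2i+1}+\sum_{i=1}^{\infty}(F^d)^{i+1}E^{2i+1}E^{\pi}\\ &+\sum_{i=1}^{\infty}F^{i}F^{\pi}E^{2i}E^dF+\sum_{i=1}^{\infty}(F^d)^{i+3}E^{2i+3}E^{\pi}F, \end{aligned}$$ $$\begin{aligned} \Delta={}&(E^d)^2+(E^d)^4F-F^d(E^d)^2F-(F^d)^2EE^dF-FF^d(E^d)^2+F^dE^{\pi}\\ &-FF^d(E^d)^4F+(F^d)^3E^2E^{\pi}F+\sum_{i=1}^{\infty}F^iF^{\pi}E^{2i+1}E^d+\sum_{i=1}^{\infty}(F^d)^{i+1}E^{2i}E^{\pi}\\ &+\sum_{i=1}^{\infty}F^iF^{\pi}E^{2i-1}E^dF+\sum_{i=1}^{\infty}(F^d)^{i+3}E^{2i+2}E^{\pi}F,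 \end{aligned}$$ $$\begin{aligned} \Lambda={}&FF^{\pi}(E^d)^2+FF^dE^{\pi}+FF^{\pi}(E^d)^4F+(F^d)^2E^2E^{\pi}F-FF^d(E^d)^2F-F^dEE^dF\\ &+\sum_{i=1}^{\infty}F^{i+1}F^{\pi}(E^d)^{2i+2}+\sum_{i=1}^{\infty}(F^d)^iE^{2i}E^{\pi}+\sum_{i=1}^{\infty}F^{i+1}F^{\pi}(E^d)^{2i+4}F\\ &+\sum_{i=1}^{\infty}(F^d)^{i+2}E^{2i+2}E^{\pi}F, \end{aligned}$$ $$\begin{aligned} \Xi={}&-FF^d(E^d)^3F-F^dE^dF+FF^{\pi}(E^d)^3-FF^dE^d+FF^{\pi}(E^d)^5F-(F^d)^2E^2E^dF+(F^d)^2EF\\ &+\sum_{i=1}^{\infty}F^{i+1}F^{\pi}(E^d)^{2i+3}+\sum_{i=1}^{\infty}(F^d)^iE^{2i-1}E^{\pi}+\sum_{i=1}^{\infty}F^{i+1}F^{\pi}(E^d)^{2i+5}F\\ &+\sum_{i=1}^{\infty}(F^d)^{i+2}E^{2i+1}E^{\pi}F. \end{aligned}$$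
   Context: An element $a$ of a complex unital Banach algebra $\mathcal{A}$ has a g-Drazin inverse if there is $b\in\mathcal{A}$ with $ab=ba$, $b=bab$ and $a-a^2b\in\mathcal{A}^{qnil}$, where $\mathcal{A}^{qnil}=\{x\in\mathcal{A}:\lim_{n\to\infty}\|x^n\|^{1/n}=0\}$. Such $b$ is unique if it exists and is denoted $a^d$. This is applied to the algebra of bounded linear operators on $X$ (for $E,F$) and on $X\oplus X$ (for $M$). $I$ is the identity operator.
   Formalization: In Γ the summands F^iF^πE^{2i+1}, F^iF^πE^{2i}E^dF become F^iF^π(E^d)^{2i+1}, F^iF^π(E^d)^{2i+3}F; in Δ, F^iF^πE^{2i+1}E^d, F^iF^πE^{2i-1}E^dF become F^iF^π(E^d)^{2i+2}, F^iF^π(E^d)^{2i+4}F; as printed the identity fails for E=diag(2,0), F=E_{21}. *)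

(* Defs.v *)
From HB Require Import structures.
From mathcomp Require Import all_boot all_order all_algebra.
From mathcomp Require Import all_classical all_reals all_analysis.
From mathcomp Require Import complex.

Set Implicit Arguments.
Unset Strict Implicit.
Unset Printing Implicit Defensive.

Import Order.TTheory GRing.Theory Num.Theory.
Import numFieldNormedType.Exports.

Local Open Scope classical_set_scope.
Local Open Scope ring_scope.

(* In a normed space over [R[i]] the library's norm is [R[i]]-valued (with zero
   imaginary part); [rnorm] is the same norm with values in [R]. *)
Definition rnorm (R : realType) (V : normedModType R[i]) (x : V) : R :=
  complex.Re `|x|.

Lemma Re_normC (R : realType) (a : R[i]) : ((complex.Re `|a|)%:C)%C = `|a|.
Proof. by rewrite RRe_real ?normr_real. Qed.

Section RealNorm.
Variables (R : realType) (V : normedModType R[i]).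
Implicit Types x y : V.

Lemma rnormE x : `|x| = ((rnorm x)%:C)%C.
Proof. by rewrite /rnorm RRe_real ?normr_real. Qed.

Lemma leRC (a b : R) : ((a%:C)%C <= (b%:C)%C) = (a <= b).
Proof. by rewrite lecE /= eqxx. Qed.

Lemma rnorm_ge0 x : 0 <= rnorm x.
Proof. rewrite -leRC -rnormE; exact: normr_ge0. Qed.

Lemma rnorm0 : rnorm (0 : V) = 0.
Proof. by rewrite /rnorm normr0. Qed.

Lemma rnorm_eq0 x : rnorm x = 0 -> x = 0.
Proof. by move=> x0; apply/eqP; rewrite -normr_eq0 rnormE x0. Qed.

Lemma rnormD x y : rnorm (x + y) <= rnorm x + rnorm y.
Proof. by rewrite -leRC rmorphD/= -!rnormE ler_normD. Qed.

Lemma rnormZ (l : R[i]) x : rnorm (l *: x) = complex.Re `|l| * rnorm x.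
Proof.
apply: (@complexI R); rewrite rmorphM /= -!rnormE normrZ.
by rewrite Re_normC.
Qed.

End RealNorm.

(* The direct sum [X (+) X] is [X * X] with the library's maximum norm; the
   library does not provide its completeness. *)
Section ProdComplete.
Variables (K : numFieldType) (U V : completeNormedModType K).

HB.instance Definition _ := Pointed.on (U * V)%type.

Lemma prod_complete (F : set_system (U * V)) :
  ProperFilter F -> cauchy F -> [cvg F in (U * V)%type].
Proof.
move=> FF Fc.
have F1 : cauchy (fst @ F).
  apply/cauchy_exP => e e0.
  have /cauchyP/(_ e e0)[p Fp] := Fc.
  by exists p.1; rewrite /nbhs/=; apply: filterS Fp => q [].
have F2 : cauchy (snd @ F).
  apply/cauchy_exP => e e0.
  have /cauchyP/(_ e e0)[p Fp] := Fc.
  by exists p.2; rewrite /nbhs/=; apply: filterS Fp => q [].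
have c1 : cvg (fst @ F) by apply: cauchy_cvg.
have c2 : cvg (snd @ F) by apply: cauchy_cvg.
have := cvg_pair c1 c2.
have -> : (fun p => (p.1, p.2)) @ F = F.
  by apply/seteqP; split=> A; rewrite /nbhs/=; apply: filterS => -[].
move=> FUV; apply/cvg_ex; exists (lim (fst @ F), lim (snd @ F)); exact: FUV.
Qed.

HB.instance Definition _ :=
  Uniform_isComplete.Build (U * V)%type prod_complete.

End ProdComplete.

Record bop (R : realType) (V : normedModType R[i]) := Bop {
  bop_fun :> V -> V;
  bop_linear : linear bop_fun;
  bop_bounded : exists M : R, forall x, rnorm (bop_fun x) <= M * rnorm x }.

HB.instance Definition _ (R : realType) (V : normedModType R[i]) :=
  gen_eqMixin (bop V).
HB.instance Definition _ (R : realType) (V : normedModType R[i]) :=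
  gen_choiceMixin (bop V).
HB.instance Definition _ (R : realType) (V : normedModType R[i]) (f : bop V) :=
  GRing.isLinear.Build R[i] V V *:%R (bop_fun f) (bop_linear f).

Section BoundedOperators.
Variables (R : realType) (V : normedModType R[i]).
Implicit Types f g h : bop V.

Lemma bopP f g : f =1 g -> f = g.
Proof.
case: f g => [f lf bf] [g lg bg] /= /funext fg; rewrite -fg in lg bg *.
by rewrite (Prop_irrelevance lg lf) (Prop_irrelevance bg bf).
Qed.

Lemma bop_bound_ge0 f :
  exists2 M : R, 0 <= M & forall x, rnorm (f x) <= M * rnorm x.
Proof.
have [M fM] := bop_bounded f; exists `|M| => // x.
by apply: le_trans (fM x) _; rewrite ler_wpM2r ?rnorm_ge0// ler_norm.
Qed.

Lemma bop0_linear : linear (fun _ : V => 0 : V).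
Proof. by move=> a x y; rewrite scaler0 addr0. Qed.

Lemma bop0_bounded : exists M : R, forall x : V, rnorm (0 : V) <= M * rnorm x.
Proof. by exists 0 => x; rewrite rnorm0 mul0r. Qed.

Definition bop0 := Bop bop0_linear bop0_bounded.

Lemma bop1_linear : linear (fun x : V => x).
Proof. by []. Qed.

Lemma bop1_bounded : exists M : R, forall x : V, rnorm x <= M * rnorm x.
Proof. by exists 1 => x; rewrite mul1r. Qed.

Definition bop1 := Bop bop1_linear bop1_bounded.

Lemma bopD_linear f g : linear (fun x => f x + g x).
Proof. by move=> a x y; rewrite !linearP/= scalerDr addrACA. Qed.

Lemma bopD_bounded f g :
  exists M : R, forall x, rnorm (f x + g x) <= M * rnorm x.
Proof.
have [[M fM] [N gN]] := (bop_bounded f, bop_bounded g).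
exists (M + N) => x; apply: le_trans (rnormD _ _) _.
by rewrite mulrDl lerD.
Qed.

Definition bopD f g := Bop (bopD_linear f g) (bopD_bounded f g).

Lemma bopZ_linear (k : R[i]) f : linear (fun x => k *: f x).
Proof. by move=> a x y; rewrite linearP/= scalerDr !scalerA mulrC. Qed.

Lemma bopZ_bounded (k : R[i]) f :
  exists M : R, forall x, rnorm (k *: f x) <= M * rnorm x.
Proof.
have [M fM] := bop_bounded f; exists (complex.Re `|k| * M) => x.
rewrite rnormZ -mulrA ler_wpM2l// -leRC Re_normC; exact: normr_ge0.
Qed.

Definition bopZ (k : R[i]) f := Bop (bopZ_linear k f) (bopZ_bounded k f).

Lemma bopM_linear f g : linear (fun x => f (g x)).
Proof. by move=> a x y; rewrite !linearP. Qed.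

Lemma bopM_bounded f g : exists M : R, forall x, rnorm (f (g x)) <= M * rnorm x.
Proof.
have [[M M0 fM] [N _ gN]] := (bop_bound_ge0 f, bop_bound_ge0 g).
exists (M * N) => x; apply: le_trans (fM _) _.
by rewrite -mulrA ler_wpM2l.
Qed.

Definition bopM f g := Bop (bopM_linear f g) (bopM_bounded f g).

Definition bopN f := bopZ (-1) f.

Let bopDA : associative bopD.
Proof. by move=> f g h; apply: bopP => x /=; rewrite addrA. Qed.
Let bopDC : commutative bopD.
Proof. by move=> f g; apply: bopP => x /=; rewrite addrC. Qed.
Let bop0D : left_id bop0 bopD.
Proof. by move=> f; apply: bopP => x /=; rewrite add0r. Qed.
Let bopND : left_inverse bop0 bopN bopD.
Proof. by move=> f; apply: bopP => x /=; rewrite scaleN1r addNr. Qed.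

HB.instance Definition _ :=
  GRing.isZmodule.Build (bop V) bopDA bopDC bop0D bopND.

Let bopMA : associative bopM.
Proof. by move=> f g h; apply: bopP. Qed.
Let bop1M : left_id bop1 bopM.
Proof. by move=> f; apply: bopP. Qed.
Let bopM1 : right_id bop1 bopM.
Proof. by move=> f; apply: bopP. Qed.
Let bopMDl : left_distributive bopM bopD.
Proof. by move=> f g h; apply: bopP. Qed.
Let bopMDr : right_distributive bopM bopD.
Proof. by move=> f g h; apply: bopP => x /=; rewrite linearD. Qed.

(* Only a [pzRingType]: the identity is zero when the space is trivial. *)
HB.instance Definition _ :=
  GRing.Zmodule_isPzRing.Build (bop V) bopMA bop1M bopM1 bopMDl bopMDr.

Let bopZA a b f : bopZ a (bopZ b f) = bopZ (a * b) f.
Proof. by apply: bopP => x /=; rewrite scalerA. Qed.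
Let bopZ1 : left_id 1 bopZ.
Proof. by move=> f; apply: bopP => x /=; rewrite scale1r. Qed.
Let bopZDr : right_distributive bopZ +%R.
Proof. by move=> a f g; apply: bopP => x /=; rewrite scalerDr. Qed.
Let bopZDl f : {morph bopZ^~ f : a b / a + b}.
Proof. by move=> a b; apply: bopP => x /=; rewrite scalerDl. Qed.

HB.instance Definition _ :=
  GRing.Zmodule_isLmodule.Build R[i] (bop V) bopZA bopZ1 bopZDr bopZDl.

Lemma bopDE f g x : (f + g) x = f x + g x. Proof. by []. Qed.
Lemma bopNE f x : (- f) x = - f x. Proof. exact: scaleN1r. Qed.
Lemma bopME f g x : (f * g) x = f (g x). Proof. by []. Qed.
Lemma bopZE a f x : (a *: f) x = a *: f x. Proof. by []. Qed.

Definition opnorm f : R := sup [set rnorm (f x) | x in [set x | rnorm x <= 1]].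

Lemma opnorm_has_sup f :
  has_sup [set rnorm (f x) | x in [set x | rnorm x <= 1]].
Proof.
split; first by exists (rnorm (f 0)), 0 => //=; rewrite rnorm0.
have [M M0 fM] := bop_bound_ge0 f; exists M => _ [x /= x1 <-].
by apply: le_trans (fM x) _; rewrite ler_piMr.
Qed.

Lemma opnorm_ge0 f : 0 <= opnorm f.
Proof.
have [_ ub] := opnorm_has_sup f; apply: le_trans (ub_le_sup ub _).
  exact: (rnorm_ge0 (f 0)).
by exists 0 => //=; rewrite rnorm0.
Qed.

Lemma le_opnorm f x : rnorm (f x) <= opnorm f * rnorm x.
Proof.
have [/eqP x0|x0] := eqVneq (rnorm x) 0.
  by rewrite (rnorm_eq0 (eqP x0)) linear0 rnorm0 mulr0.
have x_gt0 : 0 < rnorm x by rewrite lt0r x0 rnorm_ge0.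
rewrite -ler_pdivrMr// mulrC.
have Re_inv : complex.Re `|((rnorm x)^-1%:C)%C| = (rnorm x)^-1 :> R.
  by rewrite ger0_norm// -[X in X <= _]/((0 : R)%:C)%C leRC invr_ge0 rnorm_ge0.
have [_ ub] := opnorm_has_sup f; apply: (ub_le_sup ub).
exists ((rnorm x)^-1%:C%C *: x) => /=.
  by rewrite rnormZ Re_inv mulVf.
by rewrite linearZ/= rnormZ Re_inv.
Qed.

Lemma opnorm_le f (M : R) :
  0 <= M -> (forall x, rnorm (f x) <= M * rnorm x) -> opnorm f <= M.
Proof.
move=> M0 fM; apply: ge_sup; first by have [] := opnorm_has_sup f.
by move=> _ [x /= x1 <-]; apply: le_trans (fM x) _; rewrite ler_piMr.
Qed.

Definition bop_norm f : R[i] := ((opnorm f)%:C)%C.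

Let bop_normD f g : bop_norm (f + g) <= bop_norm f + bop_norm g.
Proof.
rewrite /bop_norm -rmorphD/= leRC; apply: opnorm_le => [|x].
  by rewrite addr_ge0 ?opnorm_ge0.
by rewrite mulrDl; apply: le_trans (rnormD _ _) _; rewrite lerD ?le_opnorm.
Qed.

Let Re_norm_ge0 (a : R[i]) : 0 <= complex.Re `|a|.
Proof. rewrite -leRC Re_normC; exact: normr_ge0. Qed.

Let opnormZ_le (a : R[i]) f : opnorm (a *: f) <= complex.Re `|a| * opnorm f.
Proof.
apply: opnorm_le => [|x]; first by rewrite mulr_ge0 ?opnorm_ge0.
by rewrite bopZE rnormZ -mulrA ler_wpM2l ?le_opnorm.
Qed.

Let bop_normZ (a : R[i]) f : bop_norm (a *: f) = `|a| * bop_norm f.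
Proof.
rewrite /bop_norm -[in RHS]Re_normC -rmorphM; congr (_%:C)%C.
apply/eqP; rewrite eq_le opnormZ_le andTb.
have [->|a0] := eqVneq a 0; first by rewrite normr0 mul0r opnorm_ge0.
have := opnormZ_le a^-1 (a *: f); rewrite scalerA mulVf// scale1r => H.
have aI : complex.Re `|a| * complex.Re `|a^-1| = 1.
  by apply: (@complexI R); rewrite rmorphM/= !Re_normC -normrM mulfV// normr1.
by apply: le_trans (ler_wpM2l (Re_norm_ge0 a) H) _; rewrite mulrA aI mul1r.
Qed.

Let bop_norm0_eq0 f : bop_norm f = 0 -> f = 0.
Proof.
move=> /(@complexI R) f0; apply: bopP => x; apply/rnorm_eq0/eqP.
by rewrite eq_le rnorm_ge0 andbT; have := le_opnorm f x; rewrite f0 mul0r.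
Qed.

HB.instance Definition _ :=
  Lmodule_isNormed.Build R[i] (bop V) bop_normD bop_normZ bop_norm0_eq0.

Lemma rnorm_bopE f : rnorm f = opnorm f.
Proof. by []. Qed.

Lemma rnorm_bopM f g : rnorm (f * g) <= rnorm f * rnorm g.
Proof.
rewrite !rnorm_bopE; apply: opnorm_le => [|x].
  by rewrite mulr_ge0 ?opnorm_ge0.
rewrite bopME -mulrA; apply: le_trans (le_opnorm _ _) _.
by rewrite ler_wpM2l ?opnorm_ge0 ?le_opnorm.
Qed.

End BoundedOperators.

Section BoundedOperatorsComplete.
Variables (R : realType) (V : completeNormedModType R[i]).

Lemma bop_complete (F : set_system (bop V)) :
  ProperFilter F -> cauchy F -> [cvg F in bop V].
Proof.
move=> FF Fc.
have ltRC (a b : R) : ((a%:C)%C < (b%:C)%C) = (a < b) by rewrite ltcE /= eqxx.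
have posC (e : R[i]) : 0 < e -> exists2 r : R, 0 < r & e = (r%:C)%C.
  case: e => a b; rewrite ltcE /= => /andP[/eqP -> a0]; by exists a.
have ballE (W : normedModType R[i]) (x y : W) (r : R) :
    ball x ((r%:C)%C) y <-> rnorm (x - y) < r.
  by rewrite -ball_normE /= rnormE ltRC.
have Fex (r : R) : 0 < r -> exists f, F [set g | rnorm (f - g) < r].
  move=> r0; have /cauchyP/(_ ((r%:C)%C)) := Fc.
  case; first by rewrite -[X in X < _]/((0 : R)%:C)%C ltRC.
  by move=> f Ff; exists f; apply: filterS Ff => g /ballE.
have Fx x : cvg ((fun f : bop V => f x) @ F).
  apply: cauchy_cvg; apply/cauchy_exP => _ /posC[e e0 ->].
  have x1 : 0 < rnorm x + 1 by rewrite ltr_wpDl ?rnorm_ge0.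
  have [f Ff] := Fex (e / (rnorm x + 1)) (divr_gt0 e0 x1).
  exists (f x); rewrite /nbhs /=; apply: filterS Ff => h /= fh.
  apply/ballE; rewrite -bopNE -bopDE; apply: le_lt_trans (le_opnorm _ _) _.
  apply: (@le_lt_trans _ _ (e / (rnorm x + 1) * rnorm x)).
    by rewrite ler_wpM2r ?rnorm_ge0// ltW.
  by rewrite mulrAC ltr_pdivrMr// ltr_pM2l// ltrDl.
pose g x := lim ((fun f : bop V => f x) @ F).
have gP f (r : R) : F [set h | rnorm (f - h) < r] ->
    forall x, rnorm (g x - f x) <= r * rnorm x.
  move=> Ff x; apply/ler_addgt0Pr => e e0.
  have eC : 0 < (e%:C)%C by rewrite -[X in X < _]/((0 : R)%:C)%C ltRC.
  have Fe : F [set h : bop V | rnorm (g x - h x) < e].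
    have /cvgrPdist_lt/(_ _ eC) gx := Fx x.
    by apply: (filterS _ gx) => h /=; rewrite rnormE ltRC.
  have [h [/= fh xh]] := filter_ex (filterI Ff Fe).
  have -> : g x - f x = - (f - h) x + (g x - h x).
    by rewrite bopDE bopNE opprB [RHS]addrC addrA subrK.
  apply: le_trans (rnormD _ _) _; apply: lerD (ltW xh).
  rewrite -bopNE; apply: le_trans (le_opnorm _ _) _.
  rewrite ler_wpM2r ?rnorm_ge0// -rnorm_bopE.
  by apply: ltW; rewrite /rnorm normrN.
have glin : linear g.
  move=> a x y.
  have h1 : (fun f : bop V => f (a *: x + y)) @ F --> a *: g x + g y.
    rewrite (_ : (fun _ => _) = (fun f : bop V => a *: f x + f y)); last first.
      by apply/funext => f; rewrite linearP.
    by apply: cvgD (Fx y); apply: cvgZr (Fx x).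
  exact: (cvg_unique (@norm_hausdorff _ V) (Fx _) h1).
have gbnd : exists M : R, forall x, rnorm (g x) <= M * rnorm x.
  have [f Ff] := Fex 1 ltr01; exists (1 + opnorm f) => x.
  rewrite -[g x](subrK (f x)) mulrDl; apply: le_trans (rnormD _ _) _.
  by rewrite lerD ?le_opnorm ?gP.
pose G := Bop glin gbnd.
apply/cvg_ex; exists G; apply/cvgrPdist_le => _ /posC[e e0 ->].
have e2 : 0 < e / 2 by rewrite divr_gt0.
have [f Ff] := Fex _ e2; apply: filterS (Ff) => h /= fh.
rewrite rnormE leRC -[G - h](subrKA f) [e]splitr.
apply: le_trans (rnormD _ _) _; apply: lerD; last exact: ltW.
rewrite rnorm_bopE; apply: opnorm_le => [|x]; first exact: ltW.
by rewrite bopDE bopNE; apply: gP.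
Qed.

HB.instance Definition _ := Uniform_isComplete.Build (bop V) bop_complete.

End BoundedOperatorsComplete.

Section GDrazin.
Variables (R : realType) (V : completeNormedModType R[i]).
Implicit Types a b c x : bop V.

Definition quasinilpotent x : Prop :=
  (fun n : nat => rnorm (x ^+ n) `^ n%:R^-1) @ \oo --> (0 : R).

Definition is_gDrazin a b : Prop :=
  [/\ a * b = b * a, b = b * a * b & quasinilpotent (a - a ^+ 2 * b)].

Definition has_gDrazin a : Prop := exists b, is_gDrazin a b.

(* The g-Drazin inverse of [a], with junk value [0] when there is none. *)
Definition gDrazin a : bop V := xget 0 [set b | is_gDrazin a b].

Lemma rnorm_bopX x n : rnorm (x ^+ n.+1) <= rnorm x ^+ n.+1.
Proof.
elim: n => [|n IHn]; first by rewrite !expr1.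
rewrite exprS [leRHS]exprS; apply: le_trans (rnorm_bopM _ _) _.
by rewrite ler_wpM2l ?rnorm_ge0.
Qed.

Lemma quasinilpotent_geom x (K : R) : 0 <= K -> quasinilpotent x ->
  \forall n \near \oo, K ^+ n * rnorm (x ^+ n) <= 2^-1 ^+ n.
Proof.
move=> K0 qx; have K1 : 0 < K + 1 by rewrite ltr_wpDl.
have e0 : 0 < (2 * (K + 1))^-1 by rewrite invr_gt0 mulr_gt0.
have /cvgrPdist_lt/(_ _ e0) qe := qx.
near=> n; have n0 : (0 < n)%N by near: n; exact: nbhs_infty_gt.
have : `|0 - rnorm (x ^+ n) `^ n%:R^-1| < (2 * (K + 1))^-1 by near: n.
rewrite sub0r normrN ger0_norm ?powR_ge0// => /ltW rn.
have -> : rnorm (x ^+ n) = (rnorm (x ^+ n) `^ n%:R^-1) ^+ n.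
  rewrite -powR_mulrn ?powR_ge0// -powRrM mulVf ?powRr1 ?rnorm_ge0//.
  by rewrite pnatr_eq0 -lt0n.
rewrite -exprMn lerXn2r ?nnegrE ?mulr_ge0 ?powR_ge0 ?invr_ge0//.
apply: le_trans (ler_wpM2l K0 rn) _.
rewrite invfM mulrCA ler_piMr ?invr_ge0// ler_pdivrMr// mul1r.
by rewrite lerDl.
Unshelve. all: by end_near. Qed.

Lemma is_gDrazin_absorb a b c :
  is_gDrazin a b -> is_gDrazin a c ->
  a * b = a * c * (a * b) /\ a * b = a * b * (a * c).
Proof.
move=> [ab bab _] [ac cac qc].
pose p := a * b; pose q := a * c; pose u := a - a ^+ 2 * c.
have pp : p * p = p by rewrite /p -mulrA [b * (a * b)]mulrA -bab.
have qq : q * q = q by rewrite /q -mulrA [c * (a * c)]mulrA -cac.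
have pX n : p ^+ n.+1 = p by elim: n => // n IHn; rewrite exprS IHn.
have abc : GRing.comm a b := ab; have acc : GRing.comm a c := ac.
have aq : GRing.comm a q by rewrite /q; apply: commrM.
have uE : u = a * (1 - q) by rewrite /u mulrBr mulr1 /q mulrA expr2.
have cE : GRing.comm a (1 - q) by apply: commrB => //; apply: commr1.
have ipq n : (1 - q) ^+ n.+1 = 1 - q.
  elim: n => // n IHn; rewrite exprS IHn mulrBr mulr1 mulrBl mul1r qq.
  by rewrite subrr subr0.
have uX n : u ^+ n.+1 = a ^+ n.+1 * (1 - q).
  by rewrite uE exprMn_comm// ipq.
have uX' n : u ^+ n.+1 = (1 - q) * a ^+ n.+1.
  by rewrite uX; apply/commr_sym/commrX/commr_sym.
have pb n : p = b ^+ n.+1 * a ^+ n.+1.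
  by rewrite -exprMn_comm -?ab ?pX//; apply: commr_sym.
have pb' n : p = a ^+ n.+1 * b ^+ n.+1.
  by rewrite -exprMn_comm ?pX.
have E1 n : p * (1 - q) = b ^+ n.+1 * u ^+ n.+1.
  by rewrite (pb n) uX mulrA.
have E2 n : (1 - q) * p = u ^+ n.+1 * b ^+ n.+1.
  by rewrite (pb' n) uX' mulrA.
have small (w : bop V) :
    (forall n, rnorm w <= rnorm b ^+ n.+1 * rnorm (u ^+ n.+1)) -> w = 0.
  move=> wE; apply: rnorm_eq0; apply/eqP; rewrite eq_le rnorm_ge0 andbT.
  have c0 : (fun n => 2^-1 ^+ n : R) @ \oo --> (0 : R).
    by apply: cvg_expr; rewrite ger0_norm ?invr_ge0// invf_lt1// ltr1n.
  apply/ler_addgt0Pr => e e0; rewrite add0r.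
  have /cvgrPdist_lt/(_ _ e0) ce := c0; near \oo => n.
  have n0 : (0 < n)%N by near: n; exact: nbhs_infty_gt.
  have : rnorm b ^+ n * rnorm (u ^+ n) <= 2^-1 ^+ n.
    by near: n; apply: quasinilpotent_geom; rewrite ?rnorm_ge0.
  have : `|0 - 2^-1 ^+ n| < e by near: n.
  rewrite sub0r normrN ger0_norm ?exprn_ge0 ?invr_ge0// => /ltW en bn.
  by apply: le_trans en; apply: le_trans bn; rewrite -(prednK n0).
have H1 : p * (1 - q) = 0.
  apply: small => n; rewrite (E1 n); apply: le_trans (rnorm_bopM _ _) _.
  by rewrite ler_wpM2r ?rnorm_ge0 ?rnorm_bopX.
have H2 : (1 - q) * p = 0.
  apply: small => n; rewrite (E2 n); apply: le_trans (rnorm_bopM _ _) _.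
  by rewrite mulrC ler_wpM2r ?rnorm_ge0 ?rnorm_bopX.
split; apply/eqP; rewrite -subr_eq0; apply/eqP.
  by rewrite -[X in X - _]mul1r -mulrBl.
by rewrite -[X in X - _]mulr1 -mulrBr.
Unshelve. all: by end_near. Qed.

Lemma is_gDrazin_unique a b c : is_gDrazin a b -> is_gDrazin a c -> b = c.
Proof.
move=> gb gc; have [_ bc] := is_gDrazin_absorb gb gc.
have [cb _] := is_gDrazin_absorb gc gb.
have E : a * b = a * c by rewrite bc -cb.
have [[ab bab _] [ac cac _]] := (gb, gc).
by rewrite bab -mulrA E mulrA -ab E ac -cac.
Qed.

Lemma gDrazinP a : has_gDrazin a -> is_gDrazin a (gDrazin a).
Proof. exact: xgetPex. Qed.

Lemma gDrazin_eq a b : is_gDrazin a b -> gDrazin a = b.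
Proof.
move=> ab; apply: (xget_unique 0 ab) => c ac.
exact: is_gDrazin_unique ac ab.
Qed.

End GDrazin.

Section BlockOperator.
Variables (R : realType) (V : normedModType R[i]).

Lemma rnorm_prod (p : V * V) : rnorm p = Num.max (rnorm p.1) (rnorm p.2).
Proof.
apply: (@complexI R); rewrite -rnormE prod_normE !rnormE maxElt /Num.max.
by rewrite ltcE /= eqxx /=; case: ifP.
Qed.

Variables A B C D : bop V.

Definition block_fun (z : V * V) : V * V :=
  (A z.1 + B z.2, C z.1 + D z.2).

Lemma block_linear : linear block_fun.
Proof.
move=> a x y; rewrite /block_fun /= !linearP /=.
by congr pair; rewrite addrACA -scalerDr.
Qed.

Lemma block_bounded :
  exists M : R, forall z, rnorm (block_fun z) <= M * rnorm z.
Proof.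
exists (opnorm A + opnorm B + (opnorm C + opnorm D)) => z.
have z1 : rnorm z.1 <= rnorm z by rewrite rnorm_prod le_max lexx.
have z2 : rnorm z.2 <= rnorm z by rewrite rnorm_prod le_max lexx orbT.
have le2 (f g : bop V) :
    rnorm (f z.1 + g z.2) <= (opnorm f + opnorm g) * rnorm z.
  apply: le_trans (rnormD _ _) _; rewrite mulrDl.
  by apply: lerD; apply: le_trans (le_opnorm _ _) _;
    rewrite ler_wpM2l ?opnorm_ge0.
rewrite rnorm_prod /= mulrDl ge_max; apply/andP; split.
  apply: le_trans (le2 A B) _.
  by rewrite lerDl mulr_ge0 ?addr_ge0 ?opnorm_ge0 ?rnorm_ge0.
apply: le_trans (le2 C D) _.
by rewrite lerDr mulr_ge0 ?addr_ge0 ?opnorm_ge0 ?rnorm_ge0.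
Qed.

(* The operator matrix [[A, B], [C, D]] acting on column vectors of [V * V]. *)
Definition block_op : bop (V * V)%type := Bop block_linear block_bounded.

End BlockOperator.

Notation "\sum_ ( m <= i <oo ) F" :=
  (\big[+%R/0%R]_(m <= i <oo) F%R) : ring_scope.

Definition summable_from1 (R : realType) (V : normedModType R[i])
    (u : nat -> V) : Prop :=
  cvgn (fun n => \sum_(1 <= i < n) u i).

(* Main.v *)
(* The Laurent coefficients at 0 of the resolvent of a g-Drazin invertible a are
   a^n (1 - a a^d) for n >= 0 and - (a^d)^(-n) for n < 0.  Conversely, a bounded
   operator a is g-Drazin invertible with a^d = - W_{-1} as soon as some bilateral
   sequence W satisfies W_{n+1} = a W_n + [n = -1] = W_n a + [n = -1] and, for
   every large K, |W_n| = O(K^-n) over all integers n.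

   The resolvent of M is governed by (1 - E/x - F/x^2)^-1.  Since E F^2 = 0 and
   E F E = 0, the only words in E and F that survive are F^i E^j and F^i E^j F, so
   this inverse is (1 - F/x^2)^-1 ((1 - E/x)^-1 (1 + F/x^2) - F/x^2).  Its Laurent
   coefficients are z_n = sum_{i in Z} f_i h_{n-2i}, where e and f are the
   coefficients for E and F and h_m = e_m + e_{m-2} F - [m = 2] F.  They satisfy
   z_{n+1} = E z_n + F z_{n-1} + [n = -1] = z_n E + z_{n-1} F + [n = -1], so that
   W_n = ((z_n, z_{n-1}), (F z_{n-1}, F z_{n-2} + [n = 0])) works for M, and the
   entries of M^d are - z_{-1}, - z_{-2}, - F z_{-2}, - F z_{-3}. *)

Require Import Defs.
From mathcomp Require Import all_boot all_order all_algebra.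
From mathcomp Require Import all_classical all_reals all_analysis.
From mathcomp Require Import complex.
From mathcomp Require Import zify ring lra.

Set Implicit Arguments.
Unset Strict Implicit.
Unset Printing Implicit Defensive.

Import Order.TTheory GRing.Theory Num.Theory.
Import numFieldNormedType.Exports.

Local Open Scope classical_set_scope.
Local Open Scope ring_scope.

(** * Bilateral series *)

Section RealNormConvergence.
Context {R : realType} {V : normedModType R[i]}.
Implicit Types (x l : V) (u v : nat -> V).

Lemma rnormN x : rnorm (- x) = rnorm x.
Proof. by rewrite /rnorm normrN. Qed.

Lemma rnorm_sum (I : Type) (r : seq I) (P : pred I) (G : I -> V) :
  rnorm (\sum_(i <- r | P i) G i) <= \sum_(i <- r | P i) rnorm (G i).
Proof.
elim/big_rec2: _ => [|i x y _ xy]; first by rewrite rnorm0.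
by apply: le_trans (rnormD _ _) _; rewrite lerD2l.
Qed.

(** A positive element of [R[i]] has zero imaginary part, so real radii suffice in the convergence
    criterion. *)
Lemma cvg_rnormP u l :
  (forall e : R, 0 < e -> \forall n \near \oo, rnorm (l - u n) < e) <->
  u @ \oo --> l.
Proof.
split=> [ul|/cvgrPdist_lt ul e e0].
  apply/cvgrPdist_lt => -[e e'] /[1!ltcE]/= /andP[/eqP -> e0].
  apply: filterS (ul _ e0) => n; rewrite rnormE.
  by rewrite ltcE /= eqxx.
have eC : 0 < (e%:C)%C by rewrite ltcE /= eqxx.
by apply: filterS (ul _ eC) => n; rewrite rnormE ltcE /= eqxx.
Qed.

Lemma rnorm_cvg_le u l (B : R) :
  u @ \oo --> l -> (forall n, rnorm (u n) <= B) -> rnorm l <= B.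
Proof.
move=> /cvg_rnormP ul uB; apply/ler_addgt0Pr => e /ul[n _ /(_ n (leqnn n))] un.
rewrite -(subrK (u n) l); apply: le_trans (rnormD _ _) _.
by rewrite addrC lerD// ltW.
Qed.

End RealNormConvergence.

(** Stated for additive maps so as to cover negation and both multiplications by a fixed
    operator. *)
Lemma cvg_bounded_additive (R : realType) (V W : normedModType R[i])
    (phi : {additive V -> W}) (B : R) (u : nat -> V) (l : V) :
  (forall x, rnorm (phi x) <= B * rnorm x) ->
  u @ \oo --> l -> (phi \o u) @ \oo --> phi l.
Proof.
move=> phiB /cvg_rnormP ul; apply/cvg_rnormP => e e0.
(* [B] may be zero or negative; [|B| + 1] is a positive bound in every case. *)
have B0 : 0 < `|B| + 1 by rewrite ltr_wpDl.
apply: filterS (ul _ (divr_gt0 e0 B0)) => n un /=.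
rewrite -raddfB; apply: le_lt_trans (phiB _) _.
apply: (@le_lt_trans _ _ ((`|B| + 1) * rnorm (l - u n))).
  by rewrite ler_wpM2r ?rnorm_ge0// (le_trans (ler_norm _)) ?lerDl.
by rewrite mulrC -ltr_pdivlMr.
Qed.

Lemma geometric_half_sum (R : realType) (m n : nat) :
  \sum_(m <= i < n) (2^-1 : R) ^+ i <= 2 * 2^-1 ^+ m.
Proof.
have [nm|mn] := leqP n m; first by rewrite big_geq// mulr_ge0 ?exprn_ge0 ?invr_ge0.
(* Each term equals [2 * 2^-1 ^+ i - 2 * 2^-1 ^+ i.+1], so the sum telescopes. *)
rewrite (@telescope_sumr_eq _ _ _ (fun i => - (2 * 2^-1 ^+ i)) _ (ltnW mn)).
  by rewrite opprK addrC gerBl mulr_ge0 ?exprn_ge0 ?invr_ge0.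
by move=> i _; rewrite exprS; field.
Qed.

Lemma cvg_half_expr (R : realType) : (fun n => 2^-1 ^+ n : R) @ \oo --> (0 : R).
Proof. by apply: cvg_expr; rewrite ger0_norm ?invr_ge0// invf_lt1// ltr1n. Qed.

Section GeometricSeries.
Context {R : realType} {V : completeNormedModType R[i]}.
Variables (u : nat -> V) (C : R).
Hypothesis uC : forall i, rnorm (u i) <= C * 2^-1 ^+ i.

Let C0 : 0 <= C.
Proof. by have := le_trans (rnorm_ge0 _) (uC 0); rewrite mulr1. Qed.

Let tail m n : rnorm (\sum_(m <= i < n) u i) <= 2 * C * 2^-1 ^+ m.
Proof.
apply: le_trans (rnorm_sum _ _ _) _; rewrite mulrAC mulrC.
apply: le_trans (ler_wpM2l C0 (geometric_half_sum R m n)).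
by rewrite mulr_sumr; apply: ler_sum.
Qed.

Lemma cvg_series_half : cvgn (series u).
Proof.
apply: cauchy_cvg; apply/cauchy_exP => -[e e'] /[1!ltcE]/= /andP[/eqP -> e0].
have : (fun n => 2 * C * 2^-1 ^+ n) @ \oo --> (0 : R).
  rewrite -(mulr0 (2 * C)); apply: cvgMr; exact: cvg_half_expr.
move=> /cvgrPdist_lt/(_ _ e0)[m _ /(_ m (leqnn m))] /= me.
exists (series u m), m => // n /= mn.
rewrite -ball_normE /= rnormE ltcE /= eqxx /=.
rewrite -rnormN opprB sub_series_geq//; apply: le_lt_trans (tail m n) _.
by move: me; rewrite sub0r normrN ltr_norml => /andP[].
Qed.

Lemma rnorm_lim_series_half : rnorm (lim (series u @ \oo)) <= 2 * C.
Proof.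
apply: (rnorm_cvg_le cvg_series_half) => n.
by apply: le_trans (tail 0 n) _; rewrite mulr1.
Qed.

End GeometricSeries.

Section BilateralSeries.
Context {R : realType}.

(** A relation in which both halves converge separately: identities between bilateral sums then
    follow from [is_bisum_uniq] by comparing terms. *)
Definition is_bisum {V : normedModType R[i]} (s : int -> V) (l : V) : Prop :=
  exists l1 l2, [/\ series (s \o Posz) @ \oo --> l1,
    series (s \o Negz) @ \oo --> l2 & l = l1 + l2].

Lemma is_bisum_uniq (V : normedModType R[i]) (s : int -> V) (l l' : V) :
  is_bisum s l -> is_bisum s l' -> l = l'.
Proof.
move=> [a [b [sa sb ->]]] [c [d [sc sd ->]]].
by rewrite (cvg_unique (@norm_hausdorff _ V) sa sc)
  (cvg_unique (@norm_hausdorff _ V) sb sd).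
Qed.

Lemma is_bisumD (V : normedModType R[i]) (s t : int -> V) (l m : V) :
  is_bisum s l -> is_bisum t m -> is_bisum (fun i => s i + t i) (l + m).
Proof.
move=> [a [b [sa sb ->]]] [c [d [tc td ->]]].
exists (a + c), (b + d); split; last by rewrite addrACA.
  rewrite (_ : series _ = fun n => series (s \o Posz) n + series (t \o Posz) n); last first.
    by apply/funext => n; rewrite /series /= -big_split.
  exact: cvgD.
rewrite (_ : series _ = fun n => series (s \o Negz) n + series (t \o Negz) n); last first.
  by apply/funext => n; rewrite /series /= -big_split.
exact: cvgD.
Qed.

Lemma is_bisum_additive (V W : normedModType R[i]) (phi : {additive V -> W})
    (B : R) (s : int -> V) (l : V) :
  (forall x, rnorm (phi x) <= B * rnorm x) ->
  is_bisum s l -> is_bisum (phi \o s) (phi l).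
Proof.
move=> phiB [a [b [sa sb ->]]]; exists (phi a), (phi b).
split; last by rewrite raddfD.
  rewrite (_ : series _ = phi \o series (s \o Posz)); last first.
    by apply/funext => n; rewrite /series /= raddf_sum.
  exact: cvg_bounded_additive phiB sa.
rewrite (_ : series _ = phi \o series (s \o Negz)); last first.
  by apply/funext => n; rewrite /series /= raddf_sum.
exact: cvg_bounded_additive phiB sb.
Qed.

Lemma is_bisumN (V : normedModType R[i]) (s : int -> V) (l : V) :
  is_bisum s l -> is_bisum (fun i => - s i) (- l).
Proof.
by apply: (@is_bisum_additive V V -%R 1) => x; rewrite rnormN mul1r.
Qed.

Lemma is_bisumB (V : normedModType R[i]) (s t : int -> V) (l m : V) :
  is_bisum s l -> is_bisum t m -> is_bisum (fun i => s i - t i) (l - m).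
Proof. by move=> sl /is_bisumN; apply: is_bisumD. Qed.

(** The shift only moves the term [s 0] from the nonnegative half to the negative one. *)
Lemma is_bisum_shift (V : normedModType R[i]) (s : int -> V) (l : V) :
  is_bisum s l -> is_bisum (fun i => s (i + 1)) l.
Proof.
move=> [a [b [sa sb ->]]]; exists (a - s 0), (b + s 0).
split; last by rewrite [b + _]addrC addrA subrK.
  rewrite (_ : series _ = (fun n => series (s \o Posz) n.+1 - s 0)).
    by apply: cvgB; [rewrite (cvg_shiftS (series (s \o Posz)))|exact: cvg_cst].
  apply/funext => n; rewrite /series /= big_nat_recl// addrC addKr.
  by apply: eq_bigr => i _; rewrite -PoszD addn1.
rewrite -(cvg_shiftS (series _)) /=.
rewrite (_ : (fun n => _) = (fun n => series (s \o Negz) n + s 0)).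
  by apply: cvgD => //; exact: cvg_cst.
apply/funext => n; rewrite /series /= big_nat_recl//= addrC; congr (_ + _).
by apply: eq_bigr => i _; congr s; rewrite !NegzE; lia.
Qed.

Lemma series_pred1 (V : normedModType R[i]) (k : nat) (x : V) :
  series (fun i => if i == k then x else 0) @ \oo --> x.
Proof.
rewrite -(cvg_shiftn k.+1); apply: cvg_near_cst; apply: nearW => n.
rewrite /series /= -big_mkcond /= big_nat1_eq.
by rewrite ifT// addnS ltnS leq_addl.
Qed.

Lemma is_bisum_pred1 (V : normedModType R[i]) (k : int) (x : V) :
  is_bisum (fun i => if i == k then x else 0) x.
Proof.
have s0 : series (fun=> 0 : V) @ \oo --> (0 : V).
  apply: cvg_near_cst; apply: nearW => n; exact: big1.
case: k => k; [exists x, 0|exists 0, x]; split; rewrite ?addr0 ?add0r//.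
- rewrite (_ : _ \o _ = fun i => if i == k then x else 0)//.
  exact: series_pred1.
- rewrite (_ : _ \o _ = fun i => if i == k then x else 0)//.
  exact: series_pred1.
Qed.

Lemma is_bisum0 (V : normedModType R[i]) : is_bisum (fun=> 0 : V) 0.
Proof.
rewrite (_ : (fun=> _) = (fun i : int => if i == 0 then 0 : V else 0)).
  exact: is_bisum_pred1.
by apply/funext => i; rewrite if_same.
Qed.

Definition bisum {V : completeNormedModType R[i]} (s : int -> V) : V :=
  lim (series (s \o Posz) @ \oo) + lim (series (s \o Negz) @ \oo).

Lemma bisumP (V : completeNormedModType R[i]) (s : int -> V) (C : R) :
  (forall i : nat, rnorm (s (Posz i)) <= C * 2^-1 ^+ i) ->
  (forall i : nat, rnorm (s (Negz i)) <= C * 2^-1 ^+ i) ->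
  is_bisum s (bisum s).
Proof.
by move=> sP sN; eexists; eexists; split; last reflexivity;
  apply: cvg_series_half; eassumption.
Qed.

Lemma rnorm_bisum_le (V : completeNormedModType R[i]) (s : int -> V) (C : R) :
  (forall i : nat, rnorm (s (Posz i)) <= C * 2^-1 ^+ i) ->
  (forall i : nat, rnorm (s (Negz i)) <= C * 2^-1 ^+ i) ->
  rnorm (bisum s) <= 4 * C.
Proof.
move=> sP sN; apply: le_trans (rnormD _ _) _.
have -> : 4 * C = 2 * C + 2 * C by ring.
by apply: lerD; apply: rnorm_lim_series_half; eassumption.
Qed.

End BilateralSeries.

(** * Growth condition on Laurent coefficients *)

Section LaurentBounded.
Context {R : realType}.
Implicit Types (r s : int -> R).

(** For nonnegative [r] this makes the Laurent series with coefficient [r n] at [x ^ (- n)] converge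
    for [0 < |x| < 1 / K0]: decay faster than geometric at [+oo], at most geometric growth at
    [-oo]. *)
Definition laurent_bounded r : Prop :=
  exists2 K0 : R, 1 <= K0 & forall K, K0 <= K ->
    exists C, forall n, r n <= C * K ^ (- n).

Lemma laurent_bounded_le r s :
  (forall n, r n <= s n) -> laurent_bounded s -> laurent_bounded r.
Proof.
move=> rs [K0 K1 sK]; exists K0 => // K /sK[C sC]; exists C => n.
exact: le_trans (rs n) (sC n).
Qed.

Lemma laurent_boundedD r s : laurent_bounded r -> laurent_bounded s ->
  laurent_bounded (fun n => r n + s n).
Proof.
move=> [K0 K01 rK] [L0 L01 sK]; exists (Num.max K0 L0).
  by rewrite le_max K01.
move=> K; rewrite ge_max => /andP[/rK[C rC] /sK[D sD]].
by exists (C + D) => n; rewrite mulrDl lerD.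
Qed.

Lemma laurent_boundedZ (B : R) r : 0 <= B -> laurent_bounded r ->
  laurent_bounded (fun n => B * r n).
Proof.
move=> B0 [K0 K01 rK]; exists K0 => // K /rK[C rC]; exists (B * C) => n.
by rewrite -mulrA ler_wpM2l.
Qed.

Lemma laurent_bounded_shift (k : int) r : laurent_bounded r ->
  laurent_bounded (fun n => r (n + k)).
Proof.
move=> [K0 K01 rK]; exists K0 => // K K0K; have [C rC] := rK _ K0K.
have Kneq0 : K != 0 by apply: lt0r_neq0; lra.
by exists (C * K ^ (- k)) => n; rewrite -mulrA -expfzDr// -opprD [k + n]addrC.
Qed.

Lemma laurent_bounded_pred1 (k : int) (B : R) : 0 <= B ->
  laurent_bounded (fun n => if n == k then B else 0).
Proof.
move=> B0; exists 1 => // K K1; exists (B * K ^ k) => n.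
have K0 : 0 < K by lra.
case: eqP => [->|_]; last by rewrite !mulr_ge0// exprz_ge0// ltW.
by rewrite -mulrA -expfzDr ?subrr ?mulr1// lt0r_neq0.
Qed.

End LaurentBounded.

Section BilateralMultiplication.
Context {R : realType} {V : normedModType R[i]}.
Implicit Types (c l : bop V) (s : int -> bop V).

Lemma is_bisum_mull c s l :
  is_bisum s l -> is_bisum (fun i => c * s i) (c * l).
Proof.
apply: (@is_bisum_additive _ _ _
  (c \*o (@idfun (bop V)) : {additive bop V -> bop V}) (rnorm c)) => x /=.
exact: rnorm_bopM.
Qed.

Lemma is_bisum_mulr c s l :
  is_bisum s l -> is_bisum (fun i => s i * c) (l * c).
Proof.
apply: (@is_bisum_additive _ _ _
  (c \o* (@idfun (bop V)) : {additive bop V -> bop V}) (rnorm c)) => x /=.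
by rewrite mulrC; exact: rnorm_bopM.
Qed.

End BilateralMultiplication.

(** * Convolution of bilateral sequences *)

Section Convolution.
Context {R : realType} {V : completeNormedModType R[i]}.
Implicit Types f h : int -> bop V.

(** Coefficient at [x ^ (- n)] of the product of the series with terms [f i * x ^ (- 2 * i)] and
    [h m * x ^ (- m)]; the 2 reflects that [F] comes with [x ^ (- 2)]. *)
Definition lconv f h (n : int) : bop V := bisum (fun i => f i * h (n - 2 * i)).

Variables f h : int -> bop V.
Hypothesis fb : laurent_bounded (fun n => rnorm (f n)).
Hypothesis hb : laurent_bounded (fun n => rnorm (h n)).

(* With K the rate for h, the rates 2 K^2 and K^2 / 2 for f make the two halves
   of the bilateral series geometric of ratio 1/2. *)
Let term_bound : exists2 K1 : R, 1 <= K1 & forall K, K1 <= K ->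
  exists C, forall n (i : nat),
    rnorm (f (Posz i) * h (n - 2 * Posz i)) <= C * K ^ (- n) * 2^-1 ^+ i /\
    rnorm (f (Negz i) * h (n - 2 * Negz i)) <= C * K ^ (- n) * 2^-1 ^+ i.
Proof.
have [L0 L01 fL] := fb; have [K0 K01 hK] := hb.
(* This threshold puts [K] above [K0] and both [2 * K ^+ 2] and [K ^+ 2 / 2] above [L0]. *)
exists (K0 + 2 * L0) => [|K K0K]; first by lra.
have K1 : 1 <= K by lra.
have Kgt0 : 0 < K by lra.
have Kn0 : K != 0 by apply: lt0r_neq0.
have [C1 fC1] : exists C, forall n, rnorm (f n) <= C * (2 * K ^+ 2) ^ (- n).
  by apply: fL; nra.
have [C2 fC2] : exists C, forall n, rnorm (f n) <= C * (K ^+ 2 / 2) ^ (- n).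
  by apply: fL; nra.
have [C hC] : exists C, forall n, rnorm (h n) <= C * K ^ (- n).
  by apply: hK; lra.
have C10 : 0 <= C1.
  by have := le_trans (rnorm_ge0 _) (fC1 0); rewrite oppr0 expr0z mulr1.
have C20 : 0 <= C2.
  by have := le_trans (rnorm_ge0 _) (fC2 0); rewrite oppr0 expr0z mulr1.
have C0 : 0 <= C.
  by have := le_trans (rnorm_ge0 _) (hC 0); rewrite oppr0 expr0z mulr1.
have K2z (n j : int) : K ^ (- (n - 2 * j)) = K ^ (- n) * (K ^+ 2) ^ j.
  by rewrite -[K ^+ 2]/(K ^ 2%:Z) exprz_exp -expfzDr//; congr (K ^ _); lia.
exists ((C1 + C2) * C) => n i; split.
  apply: le_trans (rnorm_bopM _ _) _.
  apply: le_trans (ler_pM (rnorm_ge0 _) (rnorm_ge0 _) (fC1 _) (hC _)) _.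
  have -> : C1 * (2 * K ^+ 2) ^ (- i%:Z) * (C * K ^ (- (n - 2 * i%:Z))) =
      C1 * (C * K ^ (- n) * 2^-1 ^+ i).
    rewrite K2z expfzMl -[2^-1 ^+ i]/(2^-1 ^ i%:Z) exprz_inv.
    have : (K ^+ 2) ^ (- i%:Z) * (K ^+ 2) ^ i%:Z = 1.
      by rewrite -expfzDr ?addNr// expf_neq0.
    by move=> E; rewrite -[RHS]mulr1 -E; ring.
  by rewrite -!mulrA ler_wpM2r// ?lerDl// !mulr_ge0// ?exprz_ge0 ?exprn_ge0
    ?invr_ge0// ltW.
apply: le_trans (rnorm_bopM _ _) _.
apply: le_trans (ler_pM (rnorm_ge0 _) (rnorm_ge0 _) (fC2 _) (hC _)) _.
have -> : C2 * (K ^+ 2 / 2) ^ (- Negz i) * (C * K ^ (- (n - 2 * Negz i))) =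
    C2 * (C * K ^ (- n) * 2^-1 ^+ i.+1).
  rewrite K2z expfzMl -[2^-1 ^+ i.+1]/(2^-1 ^ i.+1%:Z) NegzE opprK.
  have : (K ^+ 2) ^ (- i.+1%:Z) * (K ^+ 2) ^ i.+1%:Z = 1.
    by rewrite -expfzDr ?addNr// expf_neq0.
  by move=> E; rewrite -[RHS]mulr1 -E; ring.
have X0 : 0 <= C * K ^ (- n) * 2^-1 ^+ i.
  by rewrite !mulr_ge0// ?exprz_ge0 ?exprn_ge0 ?invr_ge0// ltW.
rewrite exprS -[leRHS]mulrA -[leRHS]mulrA.
move: X0; set a := K ^ _; set b := _ ^+ i => X0.
have -> : C2 * (C * a * (2^-1 * b)) = C2 * (C * a * b) / 2 by ring.
have -> : (C1 + C2) * (C * (a * b)) = C1 * (C * a * b) + C2 * (C * a * b) by ring.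
have := mulr_ge0 C10 X0; have := mulr_ge0 C20 X0; lra.
Qed.

Lemma lconvP n : is_bisum (fun i => f i * h (n - 2 * i)) (lconv f h n).
Proof.
have [K1 _ /(_ _ (lexx _))[C fhC]] := term_bound.
by apply: (@bisumP _ _ _ (C * K1 ^ (- n))) => i; have [] := fhC n i.
Qed.

Lemma laurent_bounded_lconv : laurent_bounded (fun n => rnorm (lconv f h n)).
Proof.
have [K1 K11 fhC] := term_bound; exists K1 => // K /fhC[C {}fhC].
by exists (4 * C) => n; rewrite -mulrA; apply: rnorm_bisum_le => i;
  have [] := fhC n i.
Qed.

End Convolution.

(** * Laurent coefficients of the resolvent *)

Section LaurentDrazin.
Context {R : realType} {V : completeNormedModType R[i]}.
Implicit Types (a b c : bop V) (W : int -> bop V).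

Lemma laurent_bounded_mulr W c :
  laurent_bounded (fun n => rnorm (W n)) -> laurent_bounded (fun n => rnorm (W n * c)).
Proof.
move=> /(laurent_boundedZ (rnorm_ge0 c)); apply: laurent_bounded_le => n.
by rewrite mulrC; apply: rnorm_bopM.
Qed.

Lemma laurent_bounded_mull W c :
  laurent_bounded (fun n => rnorm (W n)) -> laurent_bounded (fun n => rnorm (c * W n)).
Proof.
move=> /(laurent_boundedZ (rnorm_ge0 c)); apply: laurent_bounded_le => n.
exact: rnorm_bopM.
Qed.

Lemma laurent_bounded_delta (k : int) :
  laurent_bounded (fun n => rnorm ((n == k)%:R : bop V)).
Proof.
apply: laurent_bounded_le (laurent_bounded_pred1 k (rnorm_ge0 (1 : bop V))).
by move=> n; case: eqP => _ //=; rewrite rnorm0.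
Qed.

(** The recurrences at [n = -1] identify [W 0] with [1 - a * b] and with [1 - b * a]. The growth
    condition does the rest: it forces [b * W 0 = 0], hence [b = b * a * b], and it makes [a * W 0]
    quasinilpotent because its powers are the [W n.+1]. *)
Lemma is_gDrazin_laurent a W :
  laurent_bounded (fun n => rnorm (W n)) ->
  (forall n, W (n + 1) = a * W n + (n == -1)%:R) ->
  (forall n, W (n + 1) = W n * a + (n == -1)%:R) ->
  is_gDrazin a (- W (-1)).
Proof.
move=> [K0 K01 WK] Wl Wr; set b := - W (-1).
have W0 : W 0 = 1 - a * b.
  by have := Wl (-1); rewrite addNr eqxx => ->; rewrite /b mulrN opprK addrC.
have W0' : W 0 = 1 - b * a.
  by have := Wr (-1); rewrite addNr eqxx => ->; rewrite /b mulNr opprK addrC.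
have ab : a * b = b * a.
  by apply: oppr_inj; apply: (addrI 1); rewrite -W0.
have Wpos (n : nat) : W n = a ^+ n * W 0.
  elim: n => [|n IHn]; first by rewrite expr0 mul1r.
  by rewrite -addn1 PoszD Wl IHn addr0 addn1 exprS mulrA.
have Wneg (n : nat) : W (-1) = W (- n.+1%:Z) * a ^+ n.
  elim: n => [|n IHn]; first by rewrite expr0 mulr1.
  rewrite IHn exprS mulrA; congr (_ * _).
  have -> : - n.+1%:Z = - n.+2%:Z + 1 by lia.
  by rewrite Wr (_ : _ == _ = false) ?addr0//; lia.
(* Moving [a ^+ n] from [W (-1)] onto [W 0] gives [b * W 0 = - (W (- n.+1%:Z) * W n)] for every [n].
   Rate [K0] for the left factor and [2 * K0] for the right one leave a constant times
   [2^-1 ^+ n]. *)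
have bW0 : b * W 0 = 0.
  have [C WC] := WK _ (lexx _).
  have [D WD] : exists D, forall n, rnorm (W n) <= D * (2 * K0) ^ (- n).
    by apply: WK; lra.
  have K00 : 0 < K0 by lra.
  have bound n : rnorm (b * W 0) <= C * D * K0 * 2^-1 ^+ n.
    rewrite /b (Wneg n) mulNr rnormN -(mulrA (W _)) -Wpos.
    apply: le_trans (rnorm_bopM _ _) _.
    apply: le_trans (ler_pM (rnorm_ge0 _) (rnorm_ge0 _) (WC _) (WD _)) _.
    rewrite opprK -[n.+1]add1n PoszD expfzDr ?lt0r_neq0// expfzMl.
    rewrite -[2^-1 ^+ n]/(2^-1 ^ n%:Z) exprz_inv.
    have E : K0 ^ (- n%:Z) * K0 ^ n%:Z = 1.
      by rewrite -expfzDr ?addNr// lt0r_neq0.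
    by rewrite -[leRHS]mulr1 -E expr1z le_eqVlt; apply/orP; left; apply/eqP; ring.
  apply: rnorm_eq0; apply/eqP; rewrite eq_le rnorm_ge0 andbT.
  have c0 : (fun n => C * D * K0 * 2^-1 ^+ n) @ \oo --> (0 : R).
    by rewrite -(mulr0 (C * D * K0)); apply: cvgMr; exact: cvg_half_expr.
  by apply: (cvgr_to_ge c0); apply: nearW.
have babE : b = b * a * b.
  by apply/eqP; rewrite -subr_eq0 -mulrA -[b in b - _]mulr1 -mulrBr -W0 bW0.
split => //; set x := a - _.
have xE : x = a * W 0 by rewrite /x W0 mulrBr mulr1 expr2 mulrA.
have aW0 : GRing.comm a (W 0).
  by rewrite /GRing.comm W0 mulrBr mulrBl mulr1 mul1r ab mulrA ab.
have W00 n : W 0 ^+ n.+1 = W 0.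
  elim: n => // n IHn; rewrite exprS IHn {1}W0 mulrBl mul1r -mulrA bW0.
  by rewrite mulr0 subr0.
have xX n : x ^+ n.+1 = W n.+1.
  by rewrite xE exprMn_comm// W00 Wpos.
apply/cvgrPdist_le => e e0.
(* With [K >= 2 / e] the bound [C * K ^ (- n)] is at most [C * 2^-1 ^+ n * e ^+ n], and the factor
   [C * 2^-1 ^+ n] is eventually at most 1. *)
have [C WC] : exists C, forall n, rnorm (W n) <= C * (Num.max K0 (2 / e)) ^ (- n).
  by apply: WK; rewrite le_max lexx.
set K := Num.max _ _ in WC.
have Ke : 2 / e <= K by rewrite le_max lexx orbT.
have K_gt0 : 0 < K by rewrite lt_max divr_gt0 ?orbT.
have c0 : (fun n => C * 2^-1 ^+ n) @ \oo --> (0 : R).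
  by rewrite -(mulr0 C); apply: cvgMr; exact: cvg_half_expr.
near=> n.
have Cn : C * 2^-1 ^+ n <= 1 by near: n; exact: cvgr_le _ c0 _ ltr01.
have n0 : (0 < n)%N by near: n; exact: nbhs_infty_gt.
rewrite sub0r normrN ger0_norm ?powR_ge0//.
suff xn : rnorm (x ^+ n) <= e ^+ n.
  apply: le_trans (ge0_ler_powR _ _ _ xn) _; rewrite ?nnegrE ?invr_ge0 ?rnorm_ge0//.
    by rewrite exprn_ge0// ltW.
  rewrite -powR_mulrn ?(ltW e0)// -powRrM mulfV ?powRr1 ?(ltW e0)//.
  by rewrite pnatr_eq0 -lt0n.
rewrite -(prednK n0) xX (prednK n0); apply: le_trans (WC n) _.
have -> : C * K ^ (- n%:Z) = C * 2^-1 ^+ n * (2 / K) ^+ n.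
  rewrite exprMn -mulrA; congr (_ * _); rewrite mulrA -exprMn mulVf// expr1n mul1r.
  by rewrite -[RHS]/(K^-1 ^ n%:Z) exprz_inv.
have Kn : (2 / K) ^+ n <= e ^+ n.
  rewrite lerXn2r ?nnegrE ?divr_ge0 ?(ltW e0) ?(ltW K_gt0)//.
  by rewrite ler_pdivrMr// mulrC -ler_pdivrMr.
apply: le_trans Kn; rewrite ler_piMl// exprn_ge0// divr_ge0// ltW//.
Unshelve. all: by end_near. Qed.

End LaurentDrazin.

(** * The Laurent coefficients given by a g-Drazin inverse *)

Section DrazinLaurent.
Context {R : realType} {V : completeNormedModType R[i]}.
Implicit Types (a b c : bop V) (n : int).

(** Normalized as the coefficient at [x ^ (- n)] of the expansion of [(1 - a / x)^-1] near 0. *)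
Definition drazin_laurent a b n : bop V :=
  match n with
  | Posz k => a ^+ k * (1 - a * b)
  | Negz k => - b ^+ k.+1
  end.

Variables a b : bop V.
Hypothesis ab_gD : is_gDrazin a b.

Let ab : a * b = b * a. Proof. by case: ab_gD. Qed.
Let bab : b = b * a * b. Proof. by case: ab_gD. Qed.
Let abb : a * b * b = b. Proof. by rewrite ab -bab. Qed.

Local Notation e := (drazin_laurent a b).

(** The only jump is from -1 to 0, where [a * e (-1) = - (a * b)] while [e 0 = 1 - a * b]. *)
Lemma mulr_drazin_laurent n : a * e n = e (n + 1) - (n == -1)%:R.
Proof.
case: n => n; first by rewrite subr0 -PoszD addn1 /= mulrA -exprS.
rewrite NegzE; case: n => [|n].
  by rewrite /= subnn mulrN expr1 mul1r addrAC subrr add0r.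
have -> : - n.+2%:Z + 1 = Negz n by rewrite NegzE; lia.
by rewrite subr0 /= mulrN exprS [X in a * (_ * X)]exprS !mulrA abb -exprS.
Qed.

Lemma drazin_laurent_mulr n : e n * a = e (n + 1) - (n == -1)%:R.
Proof.
rewrite -mulr_drazin_laurent; apply/commr_sym.
have abc : GRing.comm a b := ab.
case: n => n /=; last by apply/commrN/commrX.
apply: commrM; first by apply: commrX; apply: commr_refl.
apply: commrB; first exact: commr1.
by apply: commrM => //; apply: commr_refl.
Qed.

(** Since [b = a * b * b], whatever kills [a] from the left kills [b] too; only the 1 in [e 0]
    survives. *)
Lemma annl_drazin_laurent c n : c * a = 0 -> c * e n = (n == 0)%:R * c.
Proof.
move=> ca; case: n => [[|n]|n] /=.
- by rewrite mul1r mulrBr !mulr1 mul1r mulrA ca mul0r subr0.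
- by rewrite mul0r exprS !mulrA ca !mul0r.
- by rewrite mul0r mulrN exprS -abb !mulrA ca !mul0r oppr0.
Qed.

Lemma drazin_laurent_annr c n : a * c = 0 -> e n * c = (n == 0)%:R * c.
Proof.
move=> ac; have bba : b * b * a = b by rewrite -mulrA -ab mulrA -bab.
have bc : b * c = 0 by rewrite -bba -mulrA ac mulr0.
case: n => [[|n]|n] /=.
- by rewrite !mul1r mulrBl mul1r ab -mulrA ac mulr0 subr0.
- rewrite mul0r -mulrA mulrBl mul1r ab -mulrA ac mulr0 subr0 exprSr -mulrA ac.
  by rewrite mulr0.
- by rewrite mul0r mulNr exprSr -mulrA bc mulr0 oppr0.
Qed.

(** At negative indices the powers of [b] grow at most at rate [rnorm b]; at positive ones [e n] is
    the [n]-th power of the quasinilpotent [a - a ^+ 2 * b]. *)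
Lemma laurent_bounded_drazin : laurent_bounded (fun n => rnorm (e n)).
Proof.
have [_ _ qx] := ab_gD; set x := a - _ in qx.
exists (1 + rnorm b) => [|K bK]; first by rewrite lerDl rnorm_ge0.
have b0 := rnorm_ge0 b.
have K0 : 0 < K by lra.
have abc : GRing.comm a b := ab.
have ap : GRing.comm a (1 - a * b).
  apply: commrB; first exact: commr1.
  by apply: commrM => //; apply: commr_refl.
have pp k : (1 - a * b) ^+ k.+1 = 1 - a * b.
  elim: k => // k IHk; rewrite exprS IHk mulrBl mul1r -mulrA mulrBr mulr1.
  by rewrite mulrA -bab subrr mulr0 subr0.
have xX k : x ^+ k.+1 = e k.+1.
  have -> : x = a * (1 - a * b) by rewrite /x mulrBr mulr1 mulrA expr2.
  by rewrite exprMn_comm// pp.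
have [N _ NK] := quasinilpotent_geom (ltW K0) qx.
pose C k := K ^+ k * rnorm (e (Posz k)).
have C0 k : 0 <= C k by rewrite mulr_ge0 ?exprn_ge0 ?rnorm_ge0 ?ltW.
(* The 1 covers the negative indices and those beyond [N]; the sum covers the finitely many
   others. *)
exists (1 + \sum_(0 <= k < N.+1) C k) => n.
have S0 : 0 <= \sum_(0 <= k < N.+1) C k by apply: sumr_ge0.
case: n => n; last first.
  rewrite NegzE opprK -NegzE /= rnormN; apply: le_trans (rnorm_bopX _ _) _.
  rewrite -[K ^ _]/(K ^+ n.+1); apply: (@le_trans _ _ (K ^+ n.+1)).
    by rewrite lerXn2r ?nnegrE ?rnorm_ge0 ?(ltW K0)//; lra.
  by rewrite ler_peMl ?lerDl// exprn_ge0// ltW.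
rewrite -exprz_inv -[_^-1 ^ _]/(K^-1 ^+ n) exprVn ler_pdivlMr ?exprn_gt0//.
rewrite mulrC -/(C n).
have [nN|Nn] := ltnP n N.+1.
  rewrite ler_wpDl// (big_rem n) ?mem_index_iota//= lerDl.
  exact: sumr_ge0.
apply: (@le_trans _ _ 1); last by rewrite lerDl.
case: n Nn => // n Nn; rewrite /C -xX; apply: le_trans (NK _ _) _ => /=.
  exact: ltnW.
by rewrite exprn_ile1 ?invr_ge0// invf_le1// ler1n.
Qed.

End DrazinLaurent.

(** * Calculus of operator matrices *)

Section BlockLemmas.
Context {R : realType} {V : normedModType R[i]}.
Implicit Types A B C D : bop V.

Lemma block_opM A B C D A' B' C' D' :
  block_op A B C D * block_op A' B' C' D' =
  block_op (A * A' + B * C') (A * B' + B * D')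
           (C * A' + D * C') (C * B' + D * D').
Proof.
apply: bopP => z; rewrite bopME /= /block_fun /= !linearD /=.
by congr pair; rewrite addrACA.
Qed.

Lemma block_opD A B C D A' B' C' D' :
  block_op A B C D + block_op A' B' C' D' =
  block_op (A + A') (B + B') (C + C') (D + D').
Proof.
apply: bopP => z; rewrite bopDE /= /block_fun /=.
by congr pair; rewrite addrACA.
Qed.

Lemma block_opN A B C D :
  - block_op A B C D = block_op (- A) (- B) (- C) (- D).
Proof.
apply: bopP => z; rewrite bopNE /= /block_fun /= !scaleN1r.
by rewrite -!opprD.
Qed.

(** Lets the Kronecker term of a recurrence on [V * V] be compared entry by entry. *)
Lemma block_op_nat n : n%:R = block_op n%:R 0 0 n%:R :> bop (V * V)%type.
Proof.
have E1 : 1 = block_op 1 0 0 1 :> bop (V * V)%type.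
  by apply: bopP => -[x y]; rewrite /= /block_fun /= addr0 add0r.
elim: n => [|n IHn]; first by apply: bopP => z /=; rewrite /block_fun /= !addr0.
by rewrite !mulrS IHn [X in X + block_op _ _ _ _]E1 block_opD !addr0.
Qed.

Lemma rnorm_block_op A B C D :
  rnorm (block_op A B C D) <= rnorm A + rnorm B + (rnorm C + rnorm D).
Proof.
rewrite !rnorm_bopE; apply: opnorm_le => [|z].
  by rewrite !addr_ge0 ?opnorm_ge0.
have z1 : rnorm z.1 <= rnorm z by rewrite rnorm_prod le_max lexx.
have z2 : rnorm z.2 <= rnorm z by rewrite rnorm_prod le_max lexx orbT.
have le2 (f g : bop V) :
    rnorm (f z.1 + g z.2) <= (opnorm f + opnorm g) * rnorm z.
  apply: le_trans (rnormD _ _) _; rewrite mulrDl.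
  by apply: lerD; apply: le_trans (le_opnorm _ _) _;
    rewrite ler_wpM2l ?opnorm_ge0.
rewrite [leLHS]rnorm_prod /= mulrDl ge_max; apply/andP; split.
  apply: le_trans (le2 A B) _.
  by rewrite lerDl mulr_ge0 ?addr_ge0 ?opnorm_ge0 ?rnorm_ge0.
apply: le_trans (le2 C D) _.
by rewrite lerDr mulr_ge0 ?addr_ge0 ?opnorm_ge0 ?rnorm_ge0.
Qed.

End BlockLemmas.

(** * The operator matrix *)

Section FundamentalSolution.
Context {R : realType} {X : completeNormedModType R[i]}.
Variables E F Ed Fd : bop X.
Hypotheses (E_gD : is_gDrazin E Ed) (F_gD : is_gDrazin F Fd).
Hypotheses (EFF : E * F ^+ 2 = 0) (EFE : E * F * E = 0).
Implicit Types n i : int.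

Local Notation e := (drazin_laurent E Ed).
Local Notation f := (drazin_laurent F Fd).

Let EFF0 : E * F * F = 0. Proof. by rewrite -mulrA -expr2. Qed.

Definition mixed_laurent n : bop X := e n + e (n - 2) * F - (n == 2)%:R * F.

Local Notation h := mixed_laurent.

Definition fundamental n : bop X := lconv f h n.

Local Notation z := fundamental.

Lemma laurent_bounded_mixed : laurent_bounded (fun n => rnorm (h n)).
Proof.
have eb := laurent_bounded_drazin E_gD.
pose r n := rnorm (e n) + rnorm (e (n - 2) * F) + rnorm ((n == 2)%:R * F).
apply: (@laurent_bounded_le _ _ r) => [n|].
  apply: le_trans (rnormD _ _) _; rewrite rnormN.
  by apply: lerD => //; apply: rnormD.
apply: laurent_boundedD; first apply: laurent_boundedD => //.
  by apply: laurent_bounded_mulr; apply: (laurent_bounded_shift (-2)) eb.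
by apply: laurent_bounded_mulr; apply: laurent_bounded_delta.
Qed.

Let fb := laurent_bounded_drazin F_gD.

Lemma fundamentalP n : is_bisum (fun i => f i * h (n - 2 * i)) (z n).
Proof. exact: lconvP fb laurent_bounded_mixed n. Qed.

Lemma laurent_bounded_fundamental : laurent_bounded (fun n => rnorm (z n)).
Proof. exact: laurent_bounded_lconv fb laurent_bounded_mixed. Qed.

(** [E * F] kills both [E] and [F] on its right, so of [h] only the 1 in [e 0] survives. *)
Let EF_h n : E * F * h n = (n == 0)%:R * (E * F).
Proof.
rewrite /mixed_laurent !mulrDr (annl_drazin_laurent E_gD)// mulrN !mulrA.
rewrite (annl_drazin_laurent E_gD)// -[_ * (E * F) * F]mulrA EFF0 mulr0 addr0.
by case: (n == 2); rewrite ?mulr1 ?EFF0 ?mulr0 ?mul0r subr0 ?mulrA.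
Qed.

Let E_h n : E * h n = h (n + 1) - (n == -1)%:R - (n == 2)%:R * (E * F).
Proof.
rewrite /mixed_laurent !mulrDr mulrN !mulrA !(mulr_drazin_laurent E_gD).
have -> : (n - 2 == -1) = (n == 1) by lia.
have -> : (n + 1 == 2) = (n == 1) by lia.
have -> : n - 2 + 1 = n + 1 - 2 by lia.
have -> : E * (n == 2)%:R = (n == 2)%:R * E by apply: commr_nat.
rewrite mulrBl !addrA; congr (_ - _).
by rewrite [RHS]addrAC; congr (_ - _); rewrite addrAC.
Qed.

(** [E] itself need not kill [F], but [E * F] does: expand [f i] as [F * f (i - 1) + (i == 0)%:R]
    and apply the annihilation lemma to [E * F]. *)
Let E_f i : E * f i = (i == 0)%:R * E + (i == 1)%:R * (E * F).
Proof.
have := annl_drazin_laurent F_gD (i - 1) EFF0.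
rewrite -mulrA (mulr_drazin_laurent F_gD) subrK mulrBr => /eqP.
rewrite subr_eq => /eqP ->; rewrite addrC.
have -> : (i - 1 == -1) = (i == 0) by lia.
have -> : (i - 1 == 0) = (i == 1) by lia.
by congr (_ + _); apply: commr_nat.
Qed.

(** Here the summand [- (n == 2)%:R * F] of [h] pays off: the relations reduce [e (n - 2) * F * E]
    and [e (n - 1 - 2) * F * F] to their index-0 terms, and that summand cancels these. *)
Let h_EF n : h n * E + h (n - 1) * F =
  h (n + 1) - (n == -1)%:R + (n == 1)%:R * F.
Proof.
have FFE : E * (F * F) = 0 by rewrite mulrA.
have FE : E * (F * E) = 0 by rewrite mulrA.
rewrite /mixed_laurent !mulrDl !mulNr -!mulrA (drazin_laurent_annr E_gD _ FE).
rewrite (drazin_laurent_annr E_gD _ FFE).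
rewrite !(drazin_laurent_mulr E_gD).
have -> : (n - 2 == 0) = (n == 2) by lia.
have -> : (n - 1 - 2 == 0) = (n - 1 == 2) by lia.
rewrite !addrK.
have -> : (n + 1 == 2) = (n == 1) by lia.
have -> : n + 1 - 2 = n - 1 by lia.
by rewrite [RHS]addrAC subrK [RHS]addrAC.
Qed.

Lemma mull_fundamental n : z (n + 1) = E * z n + F * z (n - 1) + (n == -1)%:R.
Proof.
(* By [E_f] only the terms [i = 0] and [i = 1] of the convolution survive; the second is
   [E * F * h (n - 2)]. Its contribution cancels the last summand of [E_h]. *)
have Ez : E * z n = E * h n + (n == 2)%:R * (E * F).
  apply: is_bisum_uniq (is_bisum_mull E (fundamentalP n)) _.
  have := is_bisumD (is_bisum_pred1 0 (E * h n))
    (is_bisum_pred1 1 ((n == 2)%:R * (E * F))).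
  rewrite (_ : (fun i => _ + _) = (fun i => E * (f i * h (n - 2 * i))))//.
  apply/funext => i; rewrite [E * (f i * _)]mulrA E_f mulrDl -!mulrA.
  congr (_ + _).
    by case: eqP => [->|_]; rewrite ?mul0r// mul1r mulr0 subr0.
  case: eqP => [->|_]; rewrite ?mul0r// mul1r [E * (F * _)]mulrA EF_h.
  by congr (_ * _); congr (_%:R); lia.
(* As [F * f i] is [f (i + 1)] except for a jump at [i = -1], this is the series of [z (n + 1)]
   reindexed, less one term. *)
have Fz : F * z (n - 1) = z (n + 1) - h (n + 1).
  apply: is_bisum_uniq (is_bisum_mull F (fundamentalP (n - 1))) _.
  have := is_bisumB (is_bisum_shift (fundamentalP (n + 1)))
    (is_bisum_pred1 (-1) (h (n + 1))).
  rewrite (_ : (fun i => _ - _) = (fun i => F * (f i * h (n - 1 - 2 * i))))//.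
  apply/funext => i; rewrite [F * (f i * _)]mulrA (mulr_drazin_laurent F_gD) mulrBl.
  congr (_ * h _ - _); first by lia.
  case: eqP => [->|_]; rewrite ?mul0r// mul1r; congr h; lia.
by rewrite Ez Fz E_h subrK [_ - _ + (_ - _)]addrC addrA !subrK.
Qed.

Lemma fundamental_mulr n : z (n + 1) = z n * E + z (n - 1) * F + (n == -1)%:R.
Proof.
have db k : laurent_bounded (fun n => rnorm ((n == k)%:R : bop X)).
  exact: laurent_bounded_delta.
(* [s] and [t] are the convolutions of [f] with the two Kronecker terms of [h_EF]; after multiplying
   [t] by [F] they cancel up to the jump of [f] at -1. *)
have sP := lconvP fb (db (-1)) n; have tP := lconvP fb (db 1) n.
set s := lconv _ _ n in sP; set t := lconv _ _ n in tP.
have tF : t * F = s - (n == -1)%:R.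
  apply: is_bisum_uniq (is_bisum_mulr F tP) _.
  have := is_bisumB (is_bisum_shift (lconvP fb (db (-1)) n))
    (is_bisum_pred1 (-1) ((n == -1)%:R : bop X)).
  rewrite (_ : (fun i => _ - _) =
    (fun i => f i * ((n - 2 * i) == 1)%:R * F))//.
  apply/funext => i.
  rewrite -mulrA (_ : _ * F = F * (n - 2 * i == 1)%:R); last exact/commr_sym/commr_nat.
  rewrite mulrA (drazin_laurent_mulr F_gD) mulrBl.
  congr (_ * _%:R - _); first by lia.
  by case: eqP => [->|_]; rewrite ?mul0r// mul1r; congr (_%:R); lia.
have zE : z n * E + z (n - 1) * F = z (n + 1) - s + t * F.
  apply: is_bisum_uniq (is_bisumD (is_bisum_mulr E (fundamentalP n))
    (is_bisum_mulr F (fundamentalP (n - 1)))) _.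
  have := is_bisumD (is_bisumB (fundamentalP (n + 1)) sP) (is_bisum_mulr F tP).
  rewrite (_ : (fun i => _ - _ + _) = (fun i =>
    f i * h (n - 2 * i) * E + f i * h (n - 1 - 2 * i) * F))//.
  apply/funext => i.
  have -> : n - 1 - 2 * i = n - 2 * i - 1 by lia.
  transitivity (f i * (h (n - 2 * i) * E + h (n - 2 * i - 1) * F)); last first.
    by rewrite mulrDr !mulrA.
  rewrite h_EF [RHS]mulrDr [X in _ = X + _]mulrBr [X in _ = _ + X]mulrA.
  by congr (_ * h _ - _ + _); lia.
by rewrite zE tF addrA !subrK.
Qed.

Definition matrix_laurent n : bop (X * X)%type :=
  block_op (z n) (z (n - 1)) (F * z (n - 1)) (F * z (n - 2) + (n == 0)%:R).

(** [block_op E 1 F 0] acts as a companion matrix: the two-step recurrences of [z], taken at [n] and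
    [n - 1], become one-step recurrences of [matrix_laurent]. *)
Lemma matrix_laurent_gDrazin :
  is_gDrazin (block_op E 1 F 0) (- matrix_laurent (-1)).
Proof.
have shift n : n + 1 - 1 = n by rewrite addrK.
have z1 n : n + 1 - 2 = n - 1 by lia.
have d1 n : (n + 1 == 0) = (n == -1) by lia.
have d2 n : (n - 1 == -1) = (n == 0) by lia.
have n2 n : n - 1 - 1 = n - 2 by lia.
apply: (@is_gDrazin_laurent _ _ _ matrix_laurent) => [|n|n].
- have zb := laurent_bounded_fundamental.
  apply: laurent_bounded_le (fun n => rnorm_block_op _ _ _ _) _.
  have zs k : laurent_bounded (fun n => rnorm (z (n + k))).
    exact: (laurent_bounded_shift k zb).
  apply: laurent_boundedD.
    by apply: laurent_boundedD => //; apply: zs.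
  apply: laurent_boundedD.
    by apply: laurent_bounded_mull; apply: zs.
  apply: laurent_bounded_le (fun n => rnormD _ _) _.
  apply: laurent_boundedD; last exact: laurent_bounded_delta.
  by apply: laurent_bounded_mull; apply: zs.
- rewrite /matrix_laurent block_opM block_op_nat block_opD shift z1 d1.
  rewrite !mul1r !mul0r !addr0 mull_fundamental; congr block_op.
  have := mull_fundamental (n - 1); rewrite subrK n2 d2 => ->.
  by rewrite addrA.
- rewrite /matrix_laurent block_opM block_op_nat block_opD shift z1 d1.
  rewrite !mulr1 !mulr0 !addr0 fundamental_mulr; congr block_op.
  have := fundamental_mulr (n - 1); rewrite subrK n2 d2 => ->.
  move: (z (n - 1)) (z (n - 2)) => u v.
  rewrite !mulrDr !mulrDl !mulrA -addrA; congr (_ + (_ + _)).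
  exact: commr_nat.
Qed.

End FundamentalSolution.

(** * Expansion of the entries *)

Section SeriesFromOne.
Context {R : realType}.

(** Splits off the first [k.+1] terms and reindexes the tail to start at 1, the form of the series
    in the entries. *)
Lemma series_from1 (V : normedModType R[i]) (t : nat -> V) (l : V) (k : nat) :
  series t @ \oo --> l ->
  summable_from1 (fun i => t (i + k)%N) /\
  l = \sum_(0 <= j < k.+1) t j + \sum_(1 <= i <oo) t (i + k)%N.
Proof.
move=> tl; set h := \sum_(0 <= j < k.+1) t j.
have tail : (fun n => \sum_(1 <= i < n) t (i + k)%N) @ \oo --> l - h.
  rewrite -(cvg_shiftS _).
  rewrite (_ : (fun n => _) = (fun n => series t (n + k.+1)%N - h)).
    by apply: cvgB; [rewrite (cvg_shiftn k.+1 (series t))|exact: cvg_cst].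
  apply/funext => n; apply/eqP; rewrite eq_sym subr_eq; apply/eqP.
  rewrite /series /= addrC (@big_cat_nat _ _ _ k.+1)//= ?leq_addl//.
  by congr (_ + _); rewrite -[k.+1]add1n big_addn addnA addn1 addnK.
split; first by apply/cvg_ex; exists (l - h).
have tlim := cvg_lim (@norm_hausdorff _ V) tail.
by rewrite tlim addrC subrK.
Qed.

Lemma sum_from1_additive (V W : normedModType R[i]) (phi : {additive V -> W})
    (B : R) (t : nat -> V) :
  (forall x, rnorm (phi x) <= B * rnorm x) -> summable_from1 t ->
  summable_from1 (phi \o t) /\
  \sum_(1 <= i <oo) phi (t i) = phi (\sum_(1 <= i <oo) t i).
Proof.
move=> phiB /(cvg_bounded_additive phiB) tl.
have : (fun n => \sum_(1 <= i < n) phi (t i)) @ \oo -->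
    phi (\sum_(1 <= i <oo) t i).
  rewrite (_ : (fun n => _) = phi \o (fun n => \sum_(1 <= i < n) t i))//.
  by apply/funext => n /=; rewrite raddf_sum.
move=> pl; split; first by apply/cvg_ex; eexists; exact: pl.
have plim := cvg_lim (@norm_hausdorff _ W) pl.
exact: plim.
Qed.

(** Termwise equality is asked only for [i > 0]: the intended identity [F * Fd ^+ i.+1 = Fd ^+ i]
    can fail at [i = 0]. *)
Lemma sum_from1_mull (V : normedModType R[i]) (c : bop V) (t s : nat -> bop V) :
  (forall i, (0 < i)%N -> s i = c * t i) -> summable_from1 t ->
  summable_from1 s /\ \sum_(1 <= i <oo) s i = c * \sum_(1 <= i <oo) t i.
Proof.
move=> sE tS; have E n : \sum_(1 <= i < n) s i = \sum_(1 <= i < n) c * t i.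
  by apply: eq_big_nat => i /andP[i0 _]; exact: sE.
rewrite /summable_from1 (funext E).
apply: (@sum_from1_additive _ _ (c \*o (@idfun (bop V)) : {additive bop V -> bop V})
  (rnorm c)) => // x; exact: rnorm_bopM.
Qed.

Lemma sum_from1_mulr (V : normedModType R[i]) (c : bop V) (t s : nat -> bop V) :
  (forall i, (0 < i)%N -> s i = t i * c) -> summable_from1 t ->
  summable_from1 s /\ \sum_(1 <= i <oo) s i = (\sum_(1 <= i <oo) t i) * c.
Proof.
move=> sE tS; have E n : \sum_(1 <= i < n) s i = \sum_(1 <= i < n) t i * c.
  by apply: eq_big_nat => i /andP[i0 _]; exact: sE.
rewrite /summable_from1 (funext E).
apply: (@sum_from1_additive _ _ (c \o* (@idfun (bop V)) : {additive bop V -> bop V})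
  (rnorm c)) => // x; rewrite mulrC; exact: rnorm_bopM.
Qed.

End SeriesFromOne.

(** * Coefficients of negative index as one-sided series *)

Section Expansion.
Context {R : realType} {X : completeNormedModType R[i]}.
Variables E F Ed Fd : bop X.
Hypotheses (E_gD : is_gDrazin E Ed) (F_gD : is_gDrazin F Fd).

Local Notation e := (drazin_laurent E Ed).
Local Notation f := (drazin_laurent F Fd).
Local Notation Ep := (1 - E * Ed).
Local Notation Fp := (1 - F * Fd).

Let eb := laurent_bounded_drazin E_gD.
Let fb := laurent_bounded_drazin F_gD.

(** The negated term of index [Posz i] in the series of [lconv f e (- m.+1%:Z)]. *)
Definition pos_term (m i : nat) : bop X := F ^+ i * Fp * Ed ^+ (2 * i + m.+1).

(* The shift k skips the initial terms in which E would have a negative exponent: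
   for i >= 1 and m <= 2 k + 3 the truncated subtraction is exact. *)
Definition neg_term (m k i : nat) : bop X :=
  Fd ^+ (i + k.+1) * E ^+ (2 * i + (2 * k + 1) - m) * Ep.

(** In the nonnegative half the index of [e] is always negative. In the other half it is
    [2 * j + 1 - m], of either sign, so the first [k.+1] terms are kept in terms of [e]. *)
Lemma lconv_drazin_pole (m k : nat) : (m <= 2 * k + 3)%N ->
  [/\ summable_from1 (pos_term m), summable_from1 (neg_term m k) &
   - lconv f e (- m.+1%:Z) =
   Fp * Ed ^+ m.+1 + \sum_(1 <= i <oo) pos_term m i +
   (\sum_(0 <= j < k.+1) Fd ^+ j.+1 * e ((2 * j + 1)%:Z - m%:Z) +
    \sum_(1 <= i <oo) neg_term m k i)].
Proof.
move=> mk; have [P [Q [sP sQ ->]]] := lconvP fb eb (- m.+1%:Z).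
have negP : series (pos_term m) @ \oo --> - P.
  rewrite (_ : series _ = fun n =>
    - series ((fun i : int => f i * e (- m.+1%:Z - 2 * i)) \o Posz) n).
    exact: cvgN.
  apply/funext => n; rewrite /series /= -sumrN; apply: eq_bigr => i _.
  have -> : - m.+1%:Z - 2 * i%:Z = Negz (2 * i + m) by rewrite NegzE; lia.
  by rewrite /= mulrN opprK /pos_term addnS.
pose q (j : nat) := Fd ^+ j.+1 * e ((2 * j + 1)%:Z - m%:Z).
have negQ : series q @ \oo --> - Q.
  rewrite (_ : series _ = fun n =>
    - series ((fun i : int => f i * e (- m.+1%:Z - 2 * i)) \o Negz) n).
    exact: cvgN.
  apply/funext => n; rewrite /series /= -sumrN; apply: eq_bigr => i _.
  rewrite mulNr opprK; congr (_ * e _); rewrite NegzE; lia.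
have [SP EP] := series_from1 0 negP; have [SQ EQ] := series_from1 k negQ.
have Pterm n : \sum_(1 <= i < n) pos_term m (i + 0) = \sum_(1 <= i < n) pos_term m i.
  by apply: eq_bigr => i _; rewrite addn0.
have Qterm n : \sum_(1 <= i < n) q (i + k)%N = \sum_(1 <= i < n) neg_term m k i.
  apply: eq_big_nat => i /andP[i0 _]; rewrite /q /neg_term (addnS i).
  have -> : (2 * (i + k) + 1)%:Z - m%:Z = (2 * i + (2 * k + 1) - m)%N by lia.
  by rewrite /= mulrA.
move: SP EP SQ EQ; rewrite /summable_from1 (funext Pterm) (funext Qterm) => SP EP SQ EQ.
split => //; rewrite opprD EP EQ big_nat1 /pos_term expr0 mul1r muln0 add0n.
by [].
Qed.

End Expansion.

Section FundamentalExpansion.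
Context {R : realType} {X : completeNormedModType R[i]}.
Variables E F Ed Fd : bop X.
Hypotheses (E_gD : is_gDrazin E Ed) (F_gD : is_gDrazin F Fd).

Local Notation e := (drazin_laurent E Ed).
Local Notation f := (drazin_laurent F Fd).

(** Convolves [f] with the three summands of [h] separately; the Kronecker part [l] depends on the
    parity of [n] and is left as a parameter. *)
Lemma fundamental_split (n : int) (l : bop X) :
  is_bisum (fun i => f i * (n - 2 * i == 2)%:R) l ->
  fundamental E F Ed Fd n = lconv f e n + lconv f e (n - 2) * F - l * F.
Proof.
have eb := laurent_bounded_drazin E_gD; have fb := laurent_bounded_drazin F_gD.
move=> /(is_bisum_mulr F) lP; apply: is_bisum_uniq (fundamentalP E_gD F_gD n) _.
have := is_bisumB (is_bisumD (lconvP fb eb n)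
  (is_bisum_mulr F (lconvP fb eb (n - 2)))) lP.
rewrite (_ : (fun i => _ + _ - _) =
  (fun i => f i * mixed_laurent E F Ed (n - 2 * i)))//.
apply/funext => i; rewrite /mixed_laurent mulrBr mulrDr !mulrA.
by congr (_ + _ * e _ * _ - _); lia.
Qed.

(** At an odd index [n - 2 * i] never equals 2, so the Kronecker part is zero. *)
Lemma fundamental_odd (m : nat) :
  - fundamental E F Ed Fd (- (2 * m + 1)%:Z) =
  - lconv f e (- (2 * m + 1)%:Z) + - lconv f e (- (2 * m + 3)%:Z) * F.
Proof.
rewrite (@fundamental_split _ 0).
  have -> : - (2 * m + 1)%:Z - 2 = - (2 * m + 3)%:Z by lia.
  by rewrite mul0r subr0 mulNr -opprD.
rewrite (_ : (fun i => _) = fun=> 0); first exact: is_bisum0.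
by apply/funext => i; rewrite (_ : _ == _ = false) ?mulr0//; lia.
Qed.

(** Only [i = -2] meets the Kronecker part, with [f (-2) = - Fd ^+ 2]. *)
Lemma fundamental_m2 :
  - fundamental E F Ed Fd (-2) =
  - lconv f e (-2) + - lconv f e (-4) * F - Fd ^+ 2 * F.
Proof.
rewrite (@fundamental_split _ (- Fd ^+ 2)).
  by rewrite !mulNr opprK -!opprD.
rewrite (_ : (fun i => _) = fun i => if i == -2 then - Fd ^+ 2 else 0).
  exact: is_bisum_pred1.
apply/funext => i; case: (eqVneq i (-2)) => [->|i2]; first by rewrite mulr1.
by rewrite (_ : _ == _ = false) ?mulr0//; lia.
Qed.

End FundamentalExpansion.

(* S1, ..., S4 stand for the sums of the four series of an entry. *)
Section EntryExpansion.
Variables (A : pzRingType) (E F Ed Fd S1 S2 S3 S4 : A).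
Hypothesis FFd2 : F * Fd * Fd = Fd.

Local Notation Ep := (1 - E * Ed).
Local Notation Fp := (1 - F * Fd).

Let expandE := (@exprS A, @expr0 A, @mulr1 A, @mul1r A, @mulrDr A, @mulrBr A, @mulrDl A,
  @mulrBl A,
  @mulrN A, @mulNr A, @mulrA A, @addrA A, @opprK A).

Lemma gamma_expansion :
  Fp * Ed ^+ 1 + S1 + (Fd ^+ 1 * (E ^+ 1 * Ep) + S2) +
  (Fp * Ed ^+ 3 + S3 + (Fd ^+ 1 * - Ed ^+ 1 + Fd ^+ 2 * (E ^+ 1 * Ep) +
    Fd ^+ 3 * (E ^+ 3 * Ep) + S4)) * F =
  Ed + Ed ^+ 3 * F - Fd * Ed * F - Fd ^+ 2 * E ^+ 2 * Ed * F - F * Fd * Ed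
  + Fd * E * Ep + Fd ^+ 2 * E * F
  - F * Fd * Ed ^+ 3 * F + Fd ^+ 3 * E ^+ 3 * Ep * F
  + S1 + S2 + S3 * F + S4 * F.
Proof.
rewrite !expandE.
(* The permutation lists the expanded monomials of the left side in the order of the right side. *)
by rewrite [LHS](ACl (1*7*10*12*2*4*5*11*8*13*14*3*6*9*15)).
Qed.

(** The [Fd ^+ 2 * F] produced by the index-0 coefficient of [E] cancels the one subtracted in
    [fundamental_m2]. *)
Lemma delta_expansion :
  Fp * Ed ^+ 2 + S1 + (Fd ^+ 1 * (E ^+ 0 * Ep) + S2) +
  (Fp * Ed ^+ 4 + S3 + (Fd ^+ 1 * - Ed ^+ 2 + Fd ^+ 2 * (E ^+ 0 * Ep) +
    Fd ^+ 3 * (E ^+ 2 * Ep) + S4)) * F - Fd ^+ 2 * F =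
  Ed ^+ 2 + Ed ^+ 4 * F - Fd * Ed ^+ 2 * F - Fd ^+ 2 * E * Ed * F
  - F * Fd * Ed ^+ 2 + Fd * Ep
  - F * Fd * Ed ^+ 4 * F + Fd ^+ 3 * E ^+ 2 * Ep * F
  + S1 + S2 + S3 * F + S4 * F.
Proof.
rewrite !expandE.
by rewrite [LHS](ACl (1*7*10*12*2*4*5*8*13*14*3*6*9*15*11*16))/= addrK.
Qed.

Lemma lambda_expansion :
  F * (Fp * Ed ^+ 2 + S1 + (Fd ^+ 1 * (E ^+ 0 * Ep) + S2) +
  (Fp * Ed ^+ 4 + S3 + (Fd ^+ 1 * - Ed ^+ 2 + Fd ^+ 2 * (E ^+ 0 * Ep) +
    Fd ^+ 3 * (E ^+ 2 * Ep) + S4)) * F - Fd ^+ 2 * F) =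
  F * Fp * Ed ^+ 2 + F * Fd * Ep + F * Fp * Ed ^+ 4 * F
  + Fd ^+ 2 * E ^+ 2 * Ep * F - F * Fd * Ed ^+ 2 * F - Fd * E * Ed * F
  + F * S1 + F * S2 + F * (S3 * F) + F * (S4 * F).
Proof.
rewrite !expandE !FFd2.
by rewrite [LHS](ACl (1*2*4*5*7*8*13*14*10*12*3*6*9*15*11*16))/= addrK.
Qed.

Lemma xi_expansion :
  F * (Fp * Ed ^+ 3 + S1 + (Fd ^+ 1 * - Ed ^+ 1 + S2) +
  (Fp * Ed ^+ 5 + S3 + (Fd ^+ 1 * - Ed ^+ 3 + Fd ^+ 2 * - Ed ^+ 1 +
    Fd ^+ 3 * (E ^+ 1 * Ep) + S4)) * F) =
  - (F * Fd * Ed ^+ 3 * F) - Fd * Ed * F + F * Fp * Ed ^+ 3 - F * Fd * Ed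
  + F * Fp * Ed ^+ 5 * F - Fd ^+ 2 * E ^+ 2 * Ed * F + Fd ^+ 2 * E * F
  + F * S1 + F * S2 + F * (S3 * F) + F * (S4 * F).
Proof.
rewrite !expandE !FFd2.
by rewrite [LHS](ACl (9*10*1*2*4*6*7*12*11*3*5*8*13)).
Qed.

End EntryExpansion.

(* In the summands ga1, ga3 (of Gamma) and de1, de3 (of Delta) the powers of E
   printed in the source make the identity false; they are replaced here by the
   powers of E^d for which it holds, and whose index-0 terms are the leading
   terms of Gamma and Delta. *)
Theorem theorem2p3 (R : realType) (X : completeNormedModType R[i])
    (E F : bop X)
    (E_gD : has_gDrazin E) (F_gD : has_gDrazin F)
    (EFF : E * F ^+ 2 = 0) (EFE : E * F * E = 0) :
  let Ed := gDrazin E in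
  let Fd := gDrazin F in
  let Ep := 1 - E * Ed in
  let Fp := 1 - F * Fd in
  let M := block_op E 1 F 0 in
  let ga1 := fun i : nat => F ^+ i * Fp * Ed ^+ (2 * i + 1) in
  let ga2 := fun i : nat => Fd ^+ (i + 1) * E ^+ (2 * i + 1) * Ep in
  let ga3 := fun i : nat => F ^+ i * Fp * Ed ^+ (2 * i + 3) * F in
  let ga4 := fun i : nat => Fd ^+ (i + 3) * E ^+ (2 * i + 3) * Ep * F in
  let de1 := fun i : nat => F ^+ i * Fp * Ed ^+ (2 * i + 2) in
  let de2 := fun i : nat => Fd ^+ (i + 1) * E ^+ (2 * i) * Ep in
  let de3 := fun i : nat => F ^+ i * Fp * Ed ^+ (2 * i + 4) * F in
  let de4 := fun i : nat => Fd ^+ (i + 3) * E ^+ (2 * i + 2) * Ep * F in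
  let la1 := fun i : nat => F ^+ (i + 1) * Fp * Ed ^+ (2 * i + 2) in
  let la2 := fun i : nat => Fd ^+ i * E ^+ (2 * i) * Ep in
  let la3 := fun i : nat => F ^+ (i + 1) * Fp * Ed ^+ (2 * i + 4) * F in
  let la4 := fun i : nat => Fd ^+ (i + 2) * E ^+ (2 * i + 2) * Ep * F in
  let xi1 := fun i : nat => F ^+ (i + 1) * Fp * Ed ^+ (2 * i + 3) in
  let xi2 := fun i : nat => Fd ^+ i * E ^+ (2 * i - 1) * Ep in
  let xi3 := fun i : nat => F ^+ (i + 1) * Fp * Ed ^+ (2 * i + 5) * F in
  let xi4 := fun i : nat => Fd ^+ (i + 2) * E ^+ (2 * i + 1) * Ep * F in
  let Gamma :=
    Ed + Ed ^+ 3 * F - Fd * Ed * F - Fd ^+ 2 * E ^+ 2 * Ed * F - F * Fd * Ed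
    + Fd * E * Ep + Fd ^+ 2 * E * F
    - F * Fd * Ed ^+ 3 * F + Fd ^+ 3 * E ^+ 3 * Ep * F
    + \sum_(1 <= i <oo) ga1 i + \sum_(1 <= i <oo) ga2 i
    + \sum_(1 <= i <oo) ga3 i + \sum_(1 <= i <oo) ga4 i in
  let Delta :=
    Ed ^+ 2 + Ed ^+ 4 * F - Fd * Ed ^+ 2 * F - Fd ^+ 2 * E * Ed * F
    - F * Fd * Ed ^+ 2 + Fd * Ep
    - F * Fd * Ed ^+ 4 * F + Fd ^+ 3 * E ^+ 2 * Ep * F
    + \sum_(1 <= i <oo) de1 i + \sum_(1 <= i <oo) de2 i
    + \sum_(1 <= i <oo) de3 i + \sum_(1 <= i <oo) de4 i in
  let Lambda :=
    F * Fp * Ed ^+ 2 + F * Fd * Ep + F * Fp * Ed ^+ 4 * F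
    + Fd ^+ 2 * E ^+ 2 * Ep * F - F * Fd * Ed ^+ 2 * F - Fd * E * Ed * F
    + \sum_(1 <= i <oo) la1 i + \sum_(1 <= i <oo) la2 i
    + \sum_(1 <= i <oo) la3 i + \sum_(1 <= i <oo) la4 i in
  let Xi :=
    - (F * Fd * Ed ^+ 3 * F) - Fd * Ed * F + F * Fp * Ed ^+ 3 - F * Fd * Ed
    + F * Fp * Ed ^+ 5 * F - Fd ^+ 2 * E ^+ 2 * Ed * F + Fd ^+ 2 * E * F
    + \sum_(1 <= i <oo) xi1 i + \sum_(1 <= i <oo) xi2 i
    + \sum_(1 <= i <oo) xi3 i + \sum_(1 <= i <oo) xi4 i in
  [/\ [/\ summable_from1 ga1, summable_from1 ga2,
          summable_from1 ga3 & summable_from1 ga4],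
      [/\ summable_from1 de1, summable_from1 de2,
          summable_from1 de3 & summable_from1 de4],
      [/\ summable_from1 la1, summable_from1 la2,
          summable_from1 la3 & summable_from1 la4],
      [/\ summable_from1 xi1, summable_from1 xi2,
          summable_from1 xi3 & summable_from1 xi4]
    & has_gDrazin M /\ gDrazin M = block_op Gamma Delta Lambda Xi].
Proof.
move=> Ed Fd Ep Fp M ga1 ga2 ga3 ga4 de1 de2 de3 de4 la1 la2 la3 la4
  xi1 xi2 xi3 xi4 Gamma Delta Lambda Xi.
have EG : is_gDrazin E Ed := gDrazinP E_gD.
have FG : is_gDrazin F Fd := gDrazinP F_gD.
pose e := drazin_laurent E Ed; pose f := drazin_laurent F Fd.
pose P := pos_term F Ed Fd; pose N := neg_term E Ed Fd.
have FdK k : F * Fd ^+ k.+2 = Fd ^+ k.+1.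
  have [FFd FdFFd _] := FG.
  by rewrite !exprS !mulrA FFd -FdFFd.
have NE m k j i : (2 * i + (2 * k + 1) - m = j)%N ->
    N m k i = Fd ^+ (i + k.+1) * E ^+ j * Ep by rewrite /N /neg_term => ->.
have FN m k j l i : (0 < i + k)%N -> (i + k = l)%N ->
    (2 * i + (2 * k + 1) - m = j)%N -> Fd ^+ l * E ^+ j * Ep = F * N m k i.
  move=> ik <- /NE ->; rewrite addnS !mulrA; case: (i + k)%N ik => // d _.
  by rewrite FdK.
have FP m i : F ^+ (i + 1) * Fp * Ed ^+ (2 * i + m.+1) = F * P m i.
  by rewrite addn1 exprS !mulrA.
have pole m k (mk : (m <= 2 * k + 3)%N) := lconv_drazin_pole EG FG mk.
(* Coefficients -1 to -5 are needed. The choice of [k] fixes where the printed series start; -3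
   occurs with [k = 2] in [Gamma] and with [k = 0] in [Xi]. *)
have [sP0 sN00 u1] := pole 0 0 isT; have [sP1 sN10 u2] := pole 1 0 isT.
have [sP2 sN20 u3] := pole 2 0 isT; have [_ sN22 u3'] := pole 2 2 isT.
have [sP3 sN32 u4] := pole 3 2 isT; have [sP4 sN42 u5] := pole 4 2 isT.
have mulF t := @sum_from1_mulr _ _ F t _ (fun _ _ => erefl).
have [sP2F P2F] := mulF _ sP2; have [sP3F P3F] := mulF _ sP3.
have [sP4F P4F] := mulF _ sP4; have [sN22F N22F] := mulF _ sN22.
have [sN32F N32F] := mulF _ sN32; have [sN42F N42F] := mulF _ sN42.
have ga2E : ga2 = N 0 0 by apply/funext => i; rewrite (NE 0 0 (2 * i + 1))%N//; lia.
have ga4E : ga4 = fun i => N 2 2 i * F.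
  by apply/funext => i; rewrite (NE 2 2 (2 * i + 3))%N//; lia.
have de2E : de2 = N 1 0 by apply/funext => i; rewrite (NE 1 0 (2 * i))%N//; lia.
have de4E : de4 = fun i => N 3 2 i * F.
  by apply/funext => i; rewrite (NE 3 2 (2 * i + 2))%N//; lia.
have [sla1 la1E] := @sum_from1_mull _ _ F _ la1 (fun i _ => FP 1 i) sP1.
have [|sla2 la2E] := @sum_from1_mull _ _ F _ la2 _ sN10.
  by move=> i i0; apply: FN; lia.
have [|sla3 la3E] := @sum_from1_mull _ _ F _ la3 _ sP3F.
  by move=> i _; rewrite [RHS]mulrA -FP.
have [|sla4 la4E] := @sum_from1_mull _ _ F _ la4 _ sN32F.
  by move=> i _; rewrite [RHS]mulrA /la4 (FN 3 2 (2 * i + 2) (i + 2) i)%N//; lia.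
have [sxi1 xi1E] := @sum_from1_mull _ _ F _ xi1 (fun i _ => FP 2 i) sP2.
have [|sxi2 xi2E] := @sum_from1_mull _ _ F _ xi2 _ sN20.
  by move=> i i0; apply: FN; lia.
have [|sxi3 xi3E] := @sum_from1_mull _ _ F _ xi3 _ sP4F.
  by move=> i _; rewrite [RHS]mulrA -FP.
have [|sxi4 xi4E] := @sum_from1_mull _ _ F _ xi4 _ sN42F.
  by move=> i _; rewrite [RHS]mulrA /xi4 (FN 4 2 (2 * i + 1) (i + 2) i)%N//; lia.
(* [ga1], [ga3], [de1] and [de3] match the [pos_term] summands by conversion. *)
split; [split|split|split|split|]; rewrite ?ga2E ?ga4E ?de2E ?de4E //.
suff MG : is_gDrazin M (block_op Gamma Delta Lambda Xi).
  by split; [exists (block_op Gamma Delta Lambda Xi)|exact: gDrazin_eq].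
have FFd2 : F * Fd * Fd = Fd by rewrite -mulrA -expr2 FdK expr1.
pose u := lconv f e; pose z := fundamental E F Ed Fd.
have z1 : - z (-1) = - u (-1) + - u (-3) * F := fundamental_odd EG FG 0.
have z2 : - z (-2) = - u (-2) + - u (-4) * F - Fd ^+ 2 * F.
  exact: fundamental_m2 EG FG.
have z3 : - z (-3) = - u (-3) + - u (-5) * F := fundamental_odd EG FG 1.
have ga3E : \sum_(1 <= i <oo) ga3 i = (\sum_(1 <= i <oo) P 2 i) * F := P2F.
have de3E : \sum_(1 <= i <oo) de3 i = (\sum_(1 <= i <oo) P 3 i) * F := P3F.
have GE : Gamma = - z (-1).
  rewrite z1 [- u (-1)]u1 [- u (-3)]u3'.
  rewrite !big_nat_recr //= !big_geq // !add0r.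
  by rewrite gamma_expansion /Gamma ga3E ga2E ga4E N22F.
have DE : Delta = - z (-2).
  rewrite z2 [- u (-2)]u2 [- u (-4)]u4.
  rewrite !big_nat_recr //= !big_geq // !add0r.
  by rewrite delta_expansion /Delta de3E de2E de4E N32F.
have LE : Lambda = - (F * z (-2)).
  rewrite -mulrN z2 [- u (-2)]u2 [- u (-4)]u4.
  rewrite !big_nat_recr //= !big_geq // !add0r.
  by rewrite lambda_expansion // /Lambda la1E la2E la3E la4E P3F N32F.
have XE : Xi = - (F * z (-3)).
  rewrite -mulrN z3 [- u (-3)]u3 [- u (-5)]u5.
  rewrite !big_nat_recr //= !big_geq // !add0r.
  by rewrite xi_expansion // /Xi xi1E xi2E xi3E xi4E P4F N42F.
have := matrix_laurent_gDrazin EG FG EFF EFE.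
by rewrite /matrix_laurent block_opN addr0 GE DE LE XE.
Qed.
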